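(* For any integer $p\ge2$ and $1\le k\le p$, let $X^{(k)},X^{(k)}_1,\dots,X^{(k)}_N$ be i.i.d. with law $\mu^{(k)}$, a sequence of random variables on the probability space $(\Omega^{(k)},\mu^{(k)})$, and let $\mathcal{F}^{(k)}$ be a class of functions defined on $(\Omega^{(k)},\mu^{(k)})$. Assume $0\in\mathcal{F}^{(k)}$ or $\mathcal{F}^{(k)}$ is symmetric (i.e. $f^{(k)}\in\mathcal{F}^{(k)}$ implies $-f^{(k)}\in\mathcal{F}^{(k)}$). Then, for any $u>0$, it holds with probability at least $1-\exp(-u^2)$ that $$\sup_{f^{(k)}\in\mathcal{F}^{(k)},\,1\le k\le p}\bigg(\sum_{i=1}^N\prod_{k=1}^p\big(f^{(k)}(X^{(k)}_i)\big)^2\bigg)^{1/2}\lesssim_p\bigg(\prod_{k=1}^pd_{\psi_2}(\mathcal{F}^{(k)})\bigg)\bigg(\sqrt N+u\sum_{k=1}^p\bar\gamma(\mathcal{F}^{(k)},\psi_2)\prod_{k'\ne k}\Big(\bar\gamma(\mathcal{F}^{(k')},\psi_2)+(\log N)^{1/2}+u\Big)\bigg),$$ where $\bar\gamma(\mathcal{F}^{(k)},\psi_2):=\gamma(\mathcal{F}^{(k)},\psi_2)/d_{\psi_2}(\mathcal{F}^{(k)})$ for each $1\le k\le p$.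
   Context: $a\lesssim_pb$ means $a\le c\,b$ for some constant $c>0$ depending only on $p$. For a function $f$ on a probability space $(\Omega,\mu)$, $\|f\|_{\psi_2}=\inf\{c>0:\mathbb{E}_{X\sim\mu}\exp(|f(X)|^2/c^2)\le2\}$ (with $\inf\emptyset=\infty$), and $d_{\psi_2}(\mathcal{F})=\sup_{f\in\mathcal{F}}\|f\|_{\psi_2}$. For each $k$ these quantities, and $\gamma(\mathcal{F}^{(k)},\psi_2)$ below, are taken with respect to $\mu^{(k)}$. Talagrand's functional: for a metric space $(\mathcal{F},d)$, an admissible sequence is an increasing sequence of subsets $\mathcal{F}_0\subset\mathcal{F}_1\subset\cdots\subset\mathcal{F}$ with $|\mathcal{F}_0|=1$, $|\mathcal{F}_s|\le2^{2^s}$ for $s\ge1$, and $\bigcup_{s}\mathcal{F}_s$ dense in $\mathcal{F}$; and $\gamma(\mathcal{F},d)=\inf\sup_{f\in\mathcal{F}}\sum_{s\ge0}2^{s/2}d(f,\mathcal{F}_s)$, the infimum being over all admissible sequences. $\gamma(\mathcal{F},\psi_2)$ denotes this functional when the distance is induced by the $\psi_2$-norm. The sequences $(X^{(k)}_i)_{i=1}^N$ and $(X^{(k')}_i)_{i=1}^N$ are not necessarily independent for $k\ne k'$.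
   Formalization: The bound is proved for u ≥ u₀ with a constant depending on p and an arbitrary fixed u₀ > 0 (no constant is uniform as u → 0), and each class F^(k) is assumed separable: a countable subclass a.s. approximates all members on the sample (false otherwise). *)

(* Defs.v *)
From HB Require Import structures.
From mathcomp Require Export all_boot all_order all_algebra.
From mathcomp Require Export all_classical all_reals all_analysis.

Set Implicit Arguments.
Unset Strict Implicit.
Unset Printing Implicit Defensive.
Import Order.TTheory GRing.Theory Num.Theory.
Import numFieldNormedType.Exports.

Local Open Scope classical_set_scope.
Local Open Scope ring_scope.
Local Open Scope ereal_scope.

(* [ereal_inf set0 = +oo], so functions with no admissible [c] have norm +oo. *)
Definition psi2_norm (d : measure_display) (T : measurableType d)
    (R : realType) (mu : probability T R) (f : T -> R) : \bar R :=
  ereal_inf [set c%:E | c in [set c : R | (0 < c)%R /\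
    'E_mu[fun x => expR (`|f x| ^+ 2 / c ^+ 2)%R] <= 2%:E]].

Definition psi2_dist (d : measure_display) (T : measurableType d)
    (R : realType) (mu : probability T R) (f g : T -> R) : \bar R :=
  psi2_norm mu (f - g)%R.

Definition psi2_diam (d : measure_display) (T : measurableType d)
    (R : realType) (mu : probability T R) (F : set (T -> R)) : \bar R :=
  ereal_sup [set psi2_norm mu f | f in F].

Section Talagrand.
Context (R : realType) (S : Type) (dist : S -> S -> \bar R).

Definition dist_to_set (x : S) (A : set S) : \bar R :=
  ereal_inf [set dist x a | a in A].

(* The increasing union is dense in [F] for the topology of [dist]. *)
Definition admissible_seq (F : set S) (A : nat -> set S) : Prop :=
  [/\ exists a, A 0%N = [set a],
      forall s, (1 <= s)%N -> (A s #<= `I_(2 ^ (2 ^ s)))%card,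
      forall s, A s `<=` A s.+1,
      forall s, A s `<=` F &
      forall x, F x -> forall e : R, (0 < e)%R ->
        exists2 a, (\bigcup_s A s) a & dist x a < e%:E].

Definition talagrand_gamma (F : set S) : \bar R :=
  ereal_inf [set
    ereal_sup [set \sum_(0 <= s <oo)
                     ((2 `^ (s%:R / 2))%:E * dist_to_set x (A s)) | x in F]
  | A in admissible_seq F].

End Talagrand.

Definition gamma_psi2 (d : measure_display) (T : measurableType d)
    (R : realType) (mu : probability T R) (F : set (T -> R)) : \bar R :=
  talagrand_gamma (psi2_dist mu) F.

(* In [\bar R], [0^-1 = +oo], [+oo^-1 = 0] and [0 * +oo = 0]. *)
Definition gamma_bar (d : measure_display) (T : measurableType d)
    (R : realType) (mu : probability T R) (F : set (T -> R)) : \bar R :=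
  gamma_psi2 mu F / psi2_diam mu F.

Definition mutually_independent (d d' : measure_display)
    (W : measurableType d) (T : measurableType d') (R : realType)
    (P : probability W R) (N : nat) (X : 'I_N -> W -> T) : Prop :=
  forall (J : {set 'I_N}) (B : 'I_N -> set T),
    (forall i, measurable (B i)) ->
    P (\bigcap_(i in [set i | i \in J]) (X i @^-1` B i)) =
    \prod_(i in J) P (X i @^-1` B i).

Definition iid_with_law (d d' : measure_display)
    (W : measurableType d) (T : measurableType d') (R : realType)
    (P : probability W R) (mu : probability T R) (N : nat)
    (X : 'I_N -> {RV P >-> T}) : Prop :=
  (forall i (B : set T), measurable B -> distribution P (X i) B = mu B) /\
  mutually_independent P (fun i => X i : W -> T).

(* Separability (in Doob's sense) of the process [f |-> (f (X_i))_{i < N}]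
   indexed by [F]; it holds in particular if [F] is countable.  Without it,
   members of [F] that vanish almost everywhere are invisible to the psi2-norm
   and yet can make a supremum over an uncountable [F] arbitrarily large. *)
Definition separable_class (d d' : measure_display)
    (W : measurableType d) (T : measurableType d') (R : realType)
    (P : probability W R) (N : nat) (X : 'I_N -> {RV P >-> T})
    (F : set (T -> R)) : Prop :=
  exists2 G : set (T -> R), countable G /\ G `<=` F &
    {ae P, forall w, forall f, F f -> forall e : R, (0 < e)%R ->
       exists2 g, G g & forall i, (`|g (X i w) - f (X i w)| < e)%R}.

(* [E] need not be measurable, hence the inner probability. *)
Definition with_probability_at_least (d : measure_display)
    (W : measurableType d) (R : realType) (P : probability W R) (q : R)
    (E : set W) : Prop :=
  exists A : set W, [/\ measurable A, A `<=` E & q%:E <= P A].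

(* Main.v *)
Require Import Defs.
From mathcomp Require Import all_boot all_order all_algebra.
From mathcomp Require Import all_classical all_reals all_analysis.
From mathcomp Require Import measurable_realfun zify ring lra.
Import Order.TTheory GRing.Theory Num.Theory.
Import numFieldNormedType.Exports.
Local Open Scope classical_set_scope.
Local Open Scope ring_scope.

(** Normalize every class to diameter one, write [gamma] for its chaining functional
    and let [y i = f (X_i) ^ 2].  The core of the argument is a bound that holds, off an
    event of probability [exp (- u ^ 2)] up to a factor, for all [f] in the class and
    all subsets [I] of the sample at once ([class_subset_bound]):

      [\sum_(i in I) y i <= C (gamma ^ 2 + u ^ 2 + m log (e N / m))],  [m = #|I|].

    It comes from generic chaining.  For one function [h] with psi2-norm below [c], the
    variables [(h (X_i) ^ 2 / c ^ 2 - log (N / m))^+] are independent, and the sum of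
    all of them has an exponential tail beyond [2 m] ([truncated_sum_tail]); this
    controls all subsets of size [m] simultaneously, at the cost of
    [m log (e N / m)].  Hence a chain need only start at the level whose net has
    about [exp (m log (e N / m) + u ^ 2)] points: at higher levels [s] the size of
    the subset is absorbed in the factor [sqrt (2 ^ s)] that defines [gamma], and the
    initial link costs the remaining two terms ([chain_sum_le]).  Measurability and
    convergence of the chains are obtained by adding a countable separating family to
    the nets, so that every chain is finite.

    The rest is deterministic.  A subset bound with parameter [a = gamma ^ 2 + u ^ 2]
    says that the entries above [t] have sum at most [a + N exp (- c t)] up to
    constants ([tail_sum_le]).  At [t] of order [log (e N)] the second term is
    negligible: the entries above that level contribute at most [C a], and the other
    factors of the product are there bounded by their maxima [a' + log (e N)].  Where
    all factors are below that level, the product is at most the sum of the [p]-th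
    powers, and integrating the tail bound yields
    [C (N + a (log (e N)) ^ (p - 1))].  Together ([sum_prod_le]):

      [\sum_i \prod_k y_k i <= C (N + \sum_k a_k \prod_(k' != k) (a_k' + log (e N)))].

    Finally a class that contains zero or is symmetric has diameter at most twice its
    [gamma] ([psi2_diam_le_gamma]), so [gamma_bar >= 1 / 2]; with [u >= u0] this turns
    [gamma_bar + u] into a multiple of [u * gamma_bar] ([rate_le]), which is the form
    of the theorem.  Classes of diameter zero vanish on the sample off an
    equally small event ([zero_diam_vanish]), and an infinite diameter or [gamma] makes the right-hand
    side infinite ([bound_pinfty]). *)

Set Implicit Arguments.
Unset Strict Implicit.
Unset Printing Implicit Defensive.

(** * The psi2-norm *)

Section Psi2.
Context (d : measure_display) (T : measurableType d) (R : realType).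
Variable mu : probability T R.
Implicit Types (f g : T -> R) (c : R).

Definition subgauss f c : Prop :=
  0 < c /\ ('E_mu[fun x => expR (`|f x| ^+ 2 / c ^+ 2)] <= 2%:E)%E.

Lemma measurable_expR_sqr f c : measurable_fun setT f ->
  measurable_fun setT (fun x => expR (`|f x| ^+ 2 / c ^+ 2)).
Proof.
move=> mf; apply: measurableT_comp => //.
apply: measurable_funM => //; apply: measurable_funX.
exact: measurableT_comp.
Qed.

Lemma expectation_le_mono (f g : T -> R) : measurable_fun setT f ->
  measurable_fun setT g -> (forall x, 0 <= f x) -> (forall x, f x <= g x) ->
  ('E_mu[f] <= 'E_mu[g])%E.
Proof.
move=> mf mg f0 fg; rewrite unlock; apply: ge0_le_integral => //.
- by move=> x _; rewrite lee_fin.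
- exact/measurable_EFinP.
- exact/measurable_EFinP.
- by move=> x _; rewrite lee_fin.
Qed.

Lemma subgauss_mono f g c c' : measurable_fun setT f -> measurable_fun setT g ->
  (forall x, `|f x| <= `|g x|) -> c <= c' -> subgauss g c -> subgauss f c'.
Proof.
move=> mf mg fg cc' [c0 gc]; have c'0 : 0 < c' by apply: lt_le_trans cc'.
split=> //; apply: le_trans gc; apply: expectation_le_mono.
- exact: measurable_expR_sqr.
- exact: measurable_expR_sqr.
- by move=> x; rewrite expR_ge0.
move=> x; rewrite ler_expR; apply: ler_pM.
- exact: sqr_ge0.
- by rewrite invr_ge0 sqr_ge0.
- by rewrite lerXn2r// ?nnegrE.
- by rewrite lef_pV2 ?posrE ?exprn_gt0// lerXn2r// ?nnegrE ltW.
Qed.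

Lemma psi2_norm_lt f c : measurable_fun setT f -> (psi2_norm mu f < c%:E)%E ->
  subgauss f c.
Proof.
move=> mf /ereal_inf_lt[_ [c' /= fc' <-]]; rewrite lte_fin => /ltW cc'.
exact: (subgauss_mono mf mf _ cc' fc').
Qed.

Lemma psi2_norm_le f c : subgauss f c -> (psi2_norm mu f <= c%:E)%E.
Proof. by move=> fc; apply: ereal_inf_lbound; exists c. Qed.

Lemma psi2_norm_ge0 f : (0 <= psi2_norm mu f)%E.
Proof.
by apply: le_ereal_inf_tmp => _ [c [c0 _] <-]; rewrite lee_fin ltW.
Qed.

Lemma le_psi2_norm f g : measurable_fun setT f -> measurable_fun setT g ->
  (forall x, `|f x| <= `|g x|) -> (psi2_norm mu f <= psi2_norm mu g)%E.
Proof.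
move=> mf mg fg; apply: le_ereal_inf_tmp => _ [c gc <-].
by apply: psi2_norm_le; exact: (subgauss_mono mf mg fg (lexx c)).
Qed.

Lemma subgauss_cst0 c : 0 < c -> subgauss 0 c.
Proof.
move=> c0; split=> //.
have -> : (fun x => expR (`|(0 : T -> R) x| ^+ 2 / c ^+ 2)) = cst 1 :> (T -> R).
  by apply/funext => x; rewrite /= normr0 expr0n mul0r expR0.
by rewrite expectation_cst lee_fin; lra.
Qed.

Lemma psi2_norm0 : psi2_norm mu 0 = 0%E.
Proof.
apply/eqP; rewrite eq_le psi2_norm_ge0 andbT.
apply/lee_addgt0Pr => e e0; rewrite add0e.
exact/psi2_norm_le/subgauss_cst0.
Qed.

(** Convexity of [x |-> exp (x ^ 2)] at the average of [a / c] and [b / c'] with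
    weights [c / (c + c')] and [c' / (c + c')]; integrated, it is the triangle
    inequality for the psi2-norm. *)
Lemma expR_sqr_convex (a b c c' : R) : 0 < c -> 0 < c' ->
  expR (`|a + b| ^+ 2 / (c + c') ^+ 2) <=
  c / (c + c') * expR (`|a| ^+ 2 / c ^+ 2) +
  c' / (c + c') * expR (`|b| ^+ 2 / c' ^+ 2).
Proof.
move=> c0 c'0; have cc0 : 0 < c + c' by rewrite addr_gt0.
set t := c / (c + c'); set t' := c' / (c + c').
have t0 : 0 <= t by rewrite divr_ge0// ltW.
have t'0 : 0 <= t' by rewrite divr_ge0// ltW.
have tt' : t + t' = 1 by rewrite /t /t' -mulrDl divff// gt_eqF.
set x := `|a| / c; set y := `|b| / c'.
have -> : `|a| ^+ 2 / c ^+ 2 = x ^+ 2 by rewrite /x expr_div_n.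
have -> : `|b| ^+ 2 / c' ^+ 2 = y ^+ 2 by rewrite /y expr_div_n.
have x0 : 0 <= x by rewrite divr_ge0// ltW.
have y0 : 0 <= y by rewrite divr_ge0// ltW.
set z := t * x ^+ 2 + t' * y ^+ 2.
have zE : `|a + b| ^+ 2 / (c + c') ^+ 2 <= z.
  apply: (@le_trans _ _ ((t * x + t' * y) ^+ 2)).
    rewrite -expr_div_n lerXn2r ?nnegrE//.
    - by rewrite divr_ge0// ltW.
    - by rewrite addr_ge0// mulr_ge0.
    have -> : t * x + t' * y = (`|a| + `|b|) / (c + c').
      by rewrite /t /t' /x /y; field; rewrite !gt_eqF.
    by rewrite ler_pM2r ?invr_gt0// ler_normD.
  have -> : (t * x + t' * y) ^+ 2 = z - t * t' * (x - y) ^+ 2.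
    have t'E : t' = 1 - t by rewrite -tt' addrC addKr.
    by rewrite /z t'E; ring.
  by rewrite lerBlDr lerDl mulr_ge0 ?sqr_ge0// mulr_ge0.
apply: (@le_trans _ _ (expR z)); first by rewrite ler_expR.
(* The tangent to [expR] at [z] lies below its graph. *)
have tangent w : expR z * (1 + (w - z)) <= expR w.
  have -> : expR w = expR z * expR (w - z) by rewrite -expRD addrC subrK.
  by rewrite ler_pM2l ?expR_gt0// expR_ge1Dx.
have -> : expR z = t * (expR z * (1 + (x ^+ 2 - z))) +
                   t' * (expR z * (1 + (y ^+ 2 - z))).
  have -> : t * (expR z * (1 + (x ^+ 2 - z))) +
      t' * (expR z * (1 + (y ^+ 2 - z))) =
      expR z * ((t + t') * (1 - z) + (t * x ^+ 2 + t' * y ^+ 2)) by ring.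
  by rewrite tt' -/z mul1r subrK mulr1.
by apply: lerD; apply: ler_wpM2l.
Qed.

Lemma subgaussD f g c c' : measurable_fun setT f -> measurable_fun setT g ->
  subgauss f c -> subgauss g c' -> subgauss (f + g) (c + c').
Proof.
move=> mf mg [c0 fc] [c'0 gc']; split; first by rewrite addr_gt0.
have cc0 : 0 < c + c' by rewrite addr_gt0.
set F := fun x => expR (`|f x| ^+ 2 / c ^+ 2).
set G := fun x => expR (`|g x| ^+ 2 / c' ^+ 2).
have mF : measurable_fun setT F by exact: measurable_expR_sqr.
have mG : measurable_fun setT G by exact: measurable_expR_sqr.
have t0 : 0 <= c / (c + c') by rewrite divr_ge0// ltW.
have t'0 : 0 <= c' / (c + c') by rewrite divr_ge0// ltW.
pose H x := c / (c + c') * F x + c' / (c + c') * G x.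
apply: (@le_trans _ _ ('E_mu[H])%E).
  apply: expectation_le_mono.
  - by apply: measurable_expR_sqr; exact: measurable_funD.
  - by apply: measurable_funD; apply: measurable_funM.
  - by move=> x; exact: expR_ge0.
  - by move=> x; exact: expR_sqr_convex.
rewrite unlock /H; under eq_integral do rewrite EFinD !EFinM.
rewrite ge0_integralD//=; last 4 first.
- by move=> x _; rewrite -EFinM lee_fin mulr_ge0// expR_ge0.
- by apply/measurable_EFinP; exact: measurable_funM.
- by move=> x _; rewrite -EFinM lee_fin mulr_ge0// expR_ge0.
- by apply/measurable_EFinP; exact: measurable_funM.
rewrite !ge0_integralZl_EFin//=; last 4 first.
- by move=> x _; rewrite lee_fin expR_ge0.
- exact/measurable_EFinP.
- by move=> x _; rewrite lee_fin expR_ge0.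
- exact/measurable_EFinP.
move: fc gc'; rewrite -/F -/G unlock => fc gc'.
have -> : 2%:E = ((c / (c + c'))%:E * 2%:E + (c' / (c + c'))%:E * 2%:E)%E.
  by rewrite -!EFinM -EFinD; congr EFin; field; rewrite gt_eqF.
by apply: leeD; apply: lee_wpmul2l => //; rewrite lee_fin.
Qed.

Lemma psi2_normD f g : measurable_fun setT f -> measurable_fun setT g ->
  (psi2_norm mu (f + g)%R <= psi2_norm mu f + psi2_norm mu g)%E.
Proof.
move=> mf mg.
have [->|fy] := eqVneq (psi2_norm mu f) +oo%E.
  by rewrite addye ?leey// gt_eqF// (lt_le_trans _ (psi2_norm_ge0 g)).
have [->|gy] := eqVneq (psi2_norm mu g) +oo%E.
  by rewrite addey ?leey// gt_eqF// (lt_le_trans _ (psi2_norm_ge0 f)).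
have ff : psi2_norm mu f \is a fin_num by rewrite ge0_fin_numE ?psi2_norm_ge0 ?ltey.
have gf : psi2_norm mu g \is a fin_num by rewrite ge0_fin_numE ?psi2_norm_ge0 ?ltey.
apply/lee_addgt0Pr => e e0.
rewrite -(fineK ff) -(fineK gf) -!EFinD.
have -> : fine (psi2_norm mu f) + fine (psi2_norm mu g) + e =
  (fine (psi2_norm mu f) + e / 2) + (fine (psi2_norm mu g) + e / 2) by field.
apply: psi2_norm_le; apply: subgaussD => //; apply: psi2_norm_lt => //.
  by rewrite -{1}(fineK ff) lte_fin ltrDl divr_gt0.
by rewrite -{1}(fineK gf) lte_fin ltrDl divr_gt0.
Qed.

End Psi2.

Section Diameter.
Context (d : measure_display) (T : measurableType d) (R : realType).
Variable mu : probability T R.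
Implicit Types (f g : T -> R) (F : set (T -> R)).

Lemma psi2_dist_ge0 f g : (0 <= psi2_dist mu f g)%E.
Proof. exact: psi2_norm_ge0. Qed.

Lemma dist_to_set_ge0 f (A : set (T -> R)) :
  (0 <= dist_to_set (psi2_dist mu) f A)%E.
Proof. by apply: le_ereal_inf_tmp => _ [g _ <-]; exact: psi2_dist_ge0. Qed.

(** The first set of an admissible sequence is a single point [a], so every [f] has
    [norm (f - a)] at most gamma; at [f = 0], or at [f = - a], this bounds the norm of
    [a] itself.  This is what the assumption that the class contains zero or is
    symmetric is for: it keeps [gamma_bar] away from zero. *)
Lemma psi2_diam_le_gamma F :
  (forall f, F f -> measurable_fun setT f) ->
  (F 0 \/ (forall f, F f -> F (- f))) ->
  (psi2_diam mu F <= 2%:E * gamma_psi2 mu F)%E.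
Proof.
move=> mF F0N; apply: ge_ereal_sup => _ [f Ff <-].
rewrite -lee_pdivrMl//; apply: le_ereal_inf_tmp => _ [A [[a A0] _ _ AF _] <-].
rewrite lee_pdivrMl//.
set G := ereal_sup _.
have Fa : F a by apply: (AF 0%N); rewrite A0.
have G1 g : F g -> (psi2_norm mu (g - a)%R <= G)%E.
  move=> Fg; apply: le_ereal_sup_tmp.
  eexists; first by exists g => //; reflexivity.
  set u := (X in (_ <= \sum_(0 <= s <oo) X s)%E).
  have u0 k : (0 <= u k)%E.
    by rewrite mule_ge0// ?dist_to_set_ge0// lee_fin powR_ge0.
  have -> : psi2_norm mu (g - a)%R = (\sum_(0 <= i < 1) u i)%E.
    rewrite big_nat1 /u mul0r powRr0 mul1e A0 /dist_to_set image_set1.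
    by rewrite ereal_inf1.
  by apply: nneseries_lim_ge => k _.
have Ga : (psi2_norm mu a <= G)%E.
  case: F0N => [F0|FN].
    apply: le_trans (G1 _ F0); apply: le_psi2_norm; first exact: mF.
      by apply: measurable_funB; exact: mF.
    by move=> x; rewrite /= sub0r normrN.
  apply: le_trans (G1 _ (FN _ Fa)); apply: le_psi2_norm; first exact: mF.
    by apply: measurable_funB; apply: mF => //; exact: FN.
  move=> x; rewrite (_ : (- a - a) x = - (a x + a x)); last by rewrite opprD.
  by rewrite normrN -mulr2n normrMn mulr2n lerDl.
have fE : f = (f - a) + a by rewrite subrK.
rewrite fE; apply: le_trans (psi2_normD _ _ _) _.
- by apply: measurable_funB; exact: mF.
- exact: mF.
- have -> : 2%:E = (1 + 1)%E :> \bar R by rewrite -EFinD.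
  rewrite ge0_muleDl// mul1e; apply: leeD => //; exact: G1.
Qed.

End Diameter.

(** * Independence and exponential tails *)

Section Independence.
Import HBNNSimple.
Context (dW d : measure_display) (W : measurableType dW) (T : measurableType d)
        (R : realType).
Variables (P : probability W R) (mu : probability T R) (N : nat)
          (X : 'I_N -> {RV P >-> T}).
Hypothesis iidX : iid_with_law mu X.

Lemma nnsfun_sum (f : {nnsfun T >-> R}) :
  exists (n : nat) (v : 'I_n -> R) (B : 'I_n -> set T),
  [/\ forall j, 0 <= v j, forall j, measurable (B j) &
      forall x, f x = \sum_(j < n) v j * \1_(B j) x].
Proof.
pose s : seq R := finmap.enum_fset (fset_set (range f)).
exists (size s), (fun j => nth 0 s j), (fun j => f @^-1` [set nth 0 s j]).
split=> [j|j|x].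
- have : nth 0 s j \in s by apply: mem_nth.
  by rewrite /s in_fset_set ?inE// => -[y _ <-].
- by [].
- rewrite fimfunE fsbig_finite//= (big_nth 0) big_mkord.
  by apply: eq_bigr.
Qed.

Lemma expectation_indic_sum (d' : measure_display) (U : measurableType d')
    (Q : probability U R) (I : finType) (v : I -> R) (B : I -> set U) :
  (forall j, 0 <= v j) -> (forall j, measurable (B j)) ->
  'E_Q[fun x => (\sum_j v j * \1_(B j) x)%R]%E = (\sum_j v j * fine (Q (B j)))%:E.
Proof.
move=> v0 mB; rewrite unlock.
under eq_integral do rewrite -sumEFin.
rewrite ge0_integral_sum//; last 2 first.
- by move=> j; apply/measurable_EFinP; apply: measurable_funM.
- by move=> j x _; rewrite lee_fin mulr_ge0.
rewrite -sumEFin; apply: eq_bigr => j _.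
under eq_integral do rewrite EFinM.
rewrite ge0_integralZl_EFin//=; last by apply/measurable_EFinP.
by rewrite integral_indic// setIT EFinM fineK// fin_num_measure.
Qed.

(** Expanding the product over the values of [f] leaves probabilities of
    intersections, one event per sample point, to which independence applies. *)
Lemma expectation_prod_nnsfun (f : {nnsfun T >-> R}) :
  'E_P[fun w => (\prod_(i < N) f (X i w))%R]%E = ('E_mu[f] ^+ N)%E.
Proof.
have [n [v [B [v0 mB fE]]]] := nnsfun_sum f.
have [lawX indX] := iidX.
pose V (h : {ffun 'I_N -> 'I_n}) := \prod_i v (h i).
pose C (h : {ffun 'I_N -> 'I_n}) :=
  \bigcap_(i in [set i | i \in [set: 'I_N]%SET]) (X i @^-1` B (h i)).
have -> : (fun w => \prod_(i < N) f (X i w)) =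
          (fun w => \sum_h V h * \1_(C h) w).
  apply/funext => w; under eq_bigr do rewrite fE.
  rewrite bigA_distr_bigA/=; apply: eq_bigr => h _.
  rewrite big_split/=; congr (_ * _).
  rewrite indicE; have [wC|wC] := boolP (w \in C h).
    apply: big1 => i _; rewrite indicE mem_set//.
    by move: wC; rewrite inE => /(_ i); apply; rewrite /= inE.
  have [i Bi] : exists i, ~ B (h i) (X i w).
    apply/not_existsP => wB; move/negP: wC; apply; rewrite inE => i _.
    exact: contrapT (wB i).
  by rewrite (bigD1 i)//= indicE memNset// mul0r.
rewrite expectation_indic_sum; last 2 first.
- by move=> h; apply: prodr_ge0.
- move=> h; apply: fin_bigcap_measurable => // i _.
  by rewrite -[X in measurable X]setTI; exact: measurable_funP.
have -> : f = (fun x => \sum_(j < n) v j * \1_(B j) x) :> (T -> R) by exact/funext.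
rewrite expectation_indic_sum// -EFin_expe; congr EFin.
rewrite -[X in _ ^+ X]card_ord -prodr_const bigA_distr_bigA/=.
apply: eq_bigr => h _; rewrite big_split/=; congr (_ * _).
rewrite /C indX//.
have -> : (\prod_(i in [set: 'I_N]%SET) P (X i @^-1` B (h i)) =
          (\prod_i fine (mu (B (h i))))%:E)%E.
  rewrite -prodEFin; apply: eq_big => [i|i _]; first by rewrite inE.
  by rewrite fineK ?fin_num_measure// -(lawX i).
by [].
Qed.

(** Monotone convergence from the case of simple functions. *)
Lemma expectation_prod_le (f : T -> R) (C : R) : measurable_fun setT f ->
  (forall x, 0 <= f x) -> ('E_mu[f] <= C%:E)%E ->
  ('E_P[fun w => (\prod_(i < N) f (X i w))%R] <= (C ^+ N)%:E)%E.
Proof.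
move=> mf f0 fC.
have mEf : measurable_fun setT (EFin \o f) by exact/measurable_EFinP.
pose g := nnsfun_approx measurableT mEf.
have gf x : EFin \o g^~ x @ \oo --> (f x)%:E.
  by apply: cvg_nnsfun_approx => // y _; rewrite /= lee_fin.
have g_mono x : {homo (fun n => g n x) : n m / (n <= m)%N >-> n <= m}.
  by move=> n m nm; have /lefP := nd_nnsfun_approx measurableT mEf nm; exact.
have gf' x : g^~ x @ \oo --> f x by have /fine_cvgP[_] := gf x.
have g_le n x : g n x <= f x.
  apply: (cvgr_to_ge (gf' x)); near=> m; apply: g_mono.
  by near: m; exact: nbhs_infty_ge.
have mX (h : T -> R) i : measurable_fun setT h ->
    measurable_fun setT (fun w => h (X i w)).
  by move=> mh; apply: measurableT_comp.
pose G n w := (\prod_(i < N) g n (X i w))%:E.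
have Gf w : G ^~ w @ \oo --> (\prod_(i < N) f (X i w))%:E.
  apply: cvg_EFin; first by near=> n.
  by apply: cvg_big => [|i _]; [exact: mul_continuous|exact: gf'].
have -> : 'E_P[fun w => (\prod_(i < N) f (X i w))%R]%E =
    (\int[P]_w limn (G ^~ w))%E.
  by rewrite unlock; apply: eq_integral => w _; apply/esym/cvg_lim.
have mG n : measurable_fun setT (G n).
  by apply/measurable_EFinP; apply: measurable_prod => i _; exact: mX.
have G0 n w : (0 <= G n w)%E by rewrite lee_fin prodr_ge0.
have G_mono w : {homo G ^~ w : n m / (n <= m)%N >-> (n <= m)%E}.
  by move=> n m nm; rewrite lee_fin ler_prod// => i _; rewrite g_mono ?fun_ge0.
apply: (cvge_to_le (cvg_monotone_convergence measurableT mG _ _)) => //.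
near=> n.
have -> : (\int[P]_w G n w = 'E_P[fun w => (\prod_(i < N) g n (X i w))%R])%E.
  by rewrite unlock.
rewrite expectation_prod_nnsfun.
have gC : ('E_mu[g n] <= C%:E)%E.
  by apply: le_trans fC; apply: expectation_le_mono.
have g0 : (0 <= 'E_mu[g n])%E by apply: expectation_ge0.
have gfin : ('E_mu[g n])%E \is a fin_num.
  by rewrite ge0_fin_numE// (le_lt_trans gC)// ltry.
move: gC g0; rewrite -(fineK gfin) -EFin_expe !lee_fin => gC g0.
by rewrite lerXn2r ?nnegrE// (le_trans g0).
Unshelve. all: by end_near. Qed.

(** The truncation [(y - tau)^+] of [y = h ^ 2 / c ^ 2] plays the part of a union
    bound over index sets of a given size: as
    [E exp ((y - tau)^+) <= 1 + 2 exp (- tau)], the expected product over the sample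
    is at most [exp (2 N exp (- tau))]. *)
Lemma truncated_sum_tail (h : T -> R) (c tau t : R) : measurable_fun setT h ->
  subgauss mu h c ->
  (P [set w | (2 * N%:R * expR (- tau) + t <
     \sum_(i < N) Num.max (`|h (X i w)| ^+ 2 / c ^+ 2 - tau) 0)%R] <=
   (expR (- t))%:E)%E.
Proof.
move=> mh [c0 hc].
pose y x := Num.max (`|h x| ^+ 2 / c ^+ 2 - tau) 0.
pose f x := expR (y x).
have my : measurable_fun setT y.
  apply: measurable_maxr => //; apply: measurable_funB => //.
  by apply: measurable_funM => //; apply: measurable_funX; exact: measurableT_comp.
have mf : measurable_fun setT f by exact: measurableT_comp.
have Ef : ('E_mu[f] <= (1 + 2 * expR (- tau))%:E)%E.
  pose g x := 1 + expR (- tau) * expR (`|h x| ^+ 2 / c ^+ 2).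
  have mE := measurable_expR_sqr c mh.
  apply: (@le_trans _ _ 'E_mu[g]%E).
    apply: expectation_le_mono => //.
    - by apply: measurable_funD => //; exact: measurable_funM.
    - by move=> x; exact: expR_ge0.
    move=> x; rewrite /f /y /g maxElt; case: ifP => _.
      by rewrite expR0 lerDl mulr_ge0 ?expR_ge0.
    by rewrite -expRD addrC lerDr.
  rewrite unlock /g; under eq_integral do rewrite EFinD EFinM.
  rewrite ge0_integralD//=; last by apply/measurable_EFinP; exact: measurable_funM.
  rewrite integral_cst//= mul1e probability_setT EFinD; apply: leeD => //.
  rewrite ge0_integralZl_EFin//=; last exact/measurable_EFinP.
  rewrite mulrC EFinM; apply: lee_wpmul2l; first by rewrite lee_fin expR_ge0.
  by move: hc; rewrite unlock.
have f0 x : 0 <= f x by exact: expR_ge0.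
have := expectation_prod_le mf f0 Ef.
set A := [set w | _].
have mS : measurable_fun setT (fun w => \sum_(i < N) y (X i w)).
  by apply: measurable_sum => i; exact: measurableT_comp.
have mA : measurable A.
  rewrite /A -[X in measurable X]setTI.
  by apply: (measurable_fun_ltr (measurable_cst _) mS).
move=> Ele.
rewrite -(@lee_pmul2l _ (expR (2 * N%:R * expR (- tau) + t))%:E)//; last first.
  by rewrite lte_fin expR_gt0.
rewrite -EFinM -expRD addrK.
apply: (@le_trans _ _ 'E_P[fun w => (\prod_(i < N) f (X i w))%R]%E).
  rewrite -(setIT A) -integral_indic// -ge0_integralZl_EFin//; last by apply/measurable_EFinP.
  rewrite unlock; apply: ge0_le_integral => //.
  - by apply/measurable_EFinP; exact: measurable_funM.
  - by apply/measurable_EFinP; apply: measurable_prod => i _; exact: measurableT_comp.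
  move=> w _; rewrite -EFinM lee_fin -expR_sum indicE.
  have [/set_mem wA|wA] := boolP (w \in A); last by rewrite mulr0 expR_ge0.
  by rewrite mulr1 ler_expR ltW.
apply: (le_trans Ele); rewrite lee_fin.
have -> : 2 * N%:R * expR (- tau) = (2 * expR (- tau)) * N%:R by ring.
rewrite expRM_natr lerXn2r ?nnegrE ?expR_ge0 ?expR_ge1Dx//.
Qed.

End Independence.

(** * Uniform control of countably many functions *)

(** [m log (e N / m)], the logarithm (up to constants) of the number of subsets of
    size [m] of a sample of size [N]. *)
Definition mlog {R : realType} (N m : nat) : R :=
  m%:R * (1 + ln (N%:R / m%:R)).

Section UnionBound.
Context (R : realType).

Lemma ln_div_ge0 N m : (0 < m <= N)%N -> 0 <= ln (N%:R / m%:R : R).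
Proof.
move=> /andP[m0 mN]; apply: ln_ge0.
by rewrite ler_pdivlMr ?ltr0n// mul1r ler_nat.
Qed.

Lemma mlog_ge_size N m : (0 < m <= N)%N -> m%:R <= mlog N m :> R.
Proof.
by move=> mN; rewrite /mlog ler_peMr// lerDl ln_div_ge0.
Qed.

Lemma mlog_ge1 N m : (0 < m <= N)%N -> 1 <= mlog N m :> R.
Proof.
move=> mN; apply: le_trans (mlog_ge_size mN).
by rewrite ler1n; case/andP: mN.
Qed.

(** [m (1 + x) >= 1 + x + (m - 1)] for [x = log (N / m)], and [m - 1 >= log m]. *)
Lemma mlog_ge_ln N m : (0 < m <= N)%N -> 1 + ln N%:R <= mlog N m :> R.
Proof.
move=> mN; have /andP[m0 _] := mN; have N0 : (0 < N)%N.
  by case/andP: mN => ? /(leq_trans _); exact.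
have x0 := ln_div_ge0 mN; rewrite /mlog; set x := ln _ in x0 *.
have -> : ln N%:R = x + ln m%:R :> R.
  by rewrite /x ln_div ?posrE ?ltr0n// subrK.
have lnm : 1 + ln m%:R <= m%:R :> R.
  by apply: le_trans (expR_ge1Dx _) _; rewrite lnK// posrE ltr0n.
have m1 : 1 <= m%:R :> R by rewrite ler1n.
nra.
Qed.

Lemma two_le_expR1 : 2 <= expR 1 :> R.
Proof. exact: le_trans (expR_ge1Dx 1). Qed.

(** [exp (- 8 * 2 ^ s)] beats the number [2 ^ (5 * 2 ^ s)] of functions. *)
Lemma expR_level_le s :
  (2 ^ (5 * 2 ^ s))%:R * expR (- (8 * (2 ^ s)%:R)) <= 2^-1 ^+ s.+1 :> R.
Proof.
have e2 : 2 <= expR 1 :> R by exact: two_le_expR1.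
have -> : expR (- (8 * (2 ^ s)%:R)) = (expR 1 ^+ (8 * 2 ^ s))^-1 :> R.
  by rewrite expRN -natrM -[in LHS](mulr1 (8 * 2 ^ s)%:R) expRM_natl.
rewrite ler_pdivrMr ?exprn_gt0 ?expR_gt0//.
rewrite exprVn mulrC ler_pdivlMr ?exprn_gt0//.
apply: (@le_trans _ _ (2 ^+ (8 * 2 ^ s))).
  rewrite natrX -exprD ler_weXn2l ?ler1n//.
  have -> : (8 * 2 ^ s = 5 * 2 ^ s + 3 * 2 ^ s)%N by rewrite -mulnDl.
  rewrite leq_add2l (leq_trans (ltn_expl s (ltnSn 1)))//.
  by rewrite leq_pmull.
by rewrite lerXn2r// nnegrE// (le_trans _ e2).
Qed.

Lemma geometric_half_le1 n : \sum_(0 <= s < n) 2^-1 ^+ s.+1 <= 1 :> R.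
Proof.
suff : \sum_(0 <= s < n) 2^-1 ^+ s.+1 = 1 - 2^-1 ^+ n :> R.
  by move=> ->; rewrite gerBl exprn_ge0.
elim: n => [|n IHn]; first by rewrite big_nil expr0 subrr.
by rewrite big_nat_recr//= IHn exprS; field.
Qed.

End UnionBound.

Section FiniteUnion.
Context (dW : measure_display) (W : measurableType dW) (R : realType).
Variable P : probability W R.

Lemma measure_bigsetU_le (n : nat) (A : nat -> set W) (e : R) :
  (forall k, (k < n)%N -> measurable (A k)) ->
  (forall k, (k < n)%N -> (P (A k) <= e%:E)%E) ->
  (P (\big[setU/set0]_(k < n) A k) <= (n%:R * e)%:E)%E.
Proof.
move=> mA Ae.
apply: (@le_trans _ _ (\sum_(k < n) P (A k))%E).
  apply: content_subadditive => //; apply: bigsetU_measurable => i _.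
  exact: mA.
apply: (@le_trans _ _ (\sum_(k < n) e%:E)%E).
  by apply: lee_sum => i _; exact: Ae.
by rewrite sumEFin lee_fin sumr_const card_ord mulr_natl.
Qed.

End FiniteUnion.

Section UniformBound.
Context (dW d : measure_display) (W : measurableType dW) (T : measurableType d)
        (R : realType).
Variables (P : probability W R) (mu : probability T R) (N : nat)
          (X : 'I_N -> {RV P >-> T}).
Hypothesis iidX : iid_with_law mu X.

Let excess (h : T -> R) (c tau : R) w :=
  \sum_(i < N) Num.max (`|h (X i w)| ^+ 2 / c ^+ 2 - tau) 0.

Lemma sum_subset_le (h : T -> R) (c t : R) w (I : {set 'I_N}) : 0 < c ->
  (0 < #|I|)%N ->
  excess h c (ln (N%:R / #|I|%:R)) w <= 2 * #|I|%:R + t ->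
  \sum_(i in I) h (X i w) ^+ 2 <= c ^+ 2 * (2 * mlog N #|I| + t).
Proof.
move=> c0 I0; set tau := ln _ => bound.
have tau0 : 0 <= tau.
  by apply: ln_div_ge0; rewrite I0 -[X in (_ <= X)%N]card_ord max_card.
have -> : \sum_(i in I) h (X i w) ^+ 2 =
    c ^+ 2 * \sum_(i in I) (`|h (X i w)| ^+ 2 / c ^+ 2).
  rewrite mulr_sumr; apply: eq_bigr => i _.
  by rewrite mulrC divfK ?sqrf_eq0 ?gt_eqF// real_normK// num_real.
rewrite ler_wpM2l ?sqr_ge0//.
apply: (@le_trans _ _ (\sum_(i in I) (tau +
    Num.max (`|h (X i w)| ^+ 2 / c ^+ 2 - tau) 0))).
  by apply: ler_sum => i _; rewrite -lerBlDl le_max lexx.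
rewrite big_split/= sumr_const.
have : \sum_(i in I) Num.max (`|h (X i w)| ^+ 2 / c ^+ 2 - tau) 0 <=
    excess h c tau w.
  rewrite /excess [leRHS](bigID (mem I))/= lerDl sumr_ge0// => i _.
  by rewrite le_max lexx orbT.
have m0 : 0 <= #|I|%:R :> R by [].
rewrite -mulr_natl /mlog -/tau => ?; nra.
Qed.

(** Level [s] has at most [2 ^ (5 * 2 ^ s)] functions, there are [N] possible sizes of
    subsets, and [exp (- mlog N m) <= 1 / N], so the tails at parameter
    [(8 + q) * (2 ^ s + mlog N m + u ^ 2)] are summable with room for the factor
    [exp (- q)], which is to pay for a union over several classes. *)
Lemma uniform_subset_bound (M : nat -> nat) (h : nat -> nat -> T -> R)
    (c : nat -> nat -> R) (q u : R) : (0 < N)%N -> 0 <= q ->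
  (forall s, (M s <= 2 ^ (5 * 2 ^ s))%N) ->
  (forall s j, measurable_fun setT (h s j)) ->
  (forall s j, subgauss mu (h s j) (c s j)) ->
  exists B : set W, [/\ measurable B, (P B <= (expR (- q - u ^+ 2))%:E)%E &
    forall w, ~ B w -> forall s j (I : {set 'I_N}), (j < M s)%N -> (0 < #|I|)%N ->
    \sum_(i in I) h s j (X i w) ^+ 2 <= c s j ^+ 2 *
      (2 * mlog N #|I| + (8 + q) * ((2 ^ s)%:R + mlog N #|I| + u ^+ 2))].
Proof.
move=> N0 q0 Mle mh hc.
pose t s m : R := (8 + q) * ((2 ^ s)%:R + mlog N m + u ^+ 2).
pose tau m : R := ln (N%:R / m%:R).
pose A s j m := [set w | 2 * m%:R + t s m < excess (h s j) (c s j) (tau m) w].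
pose Bs s := \big[setU/set0]_(j < M s) \big[setU/set0]_(m < N) A s j m.+1.
have mA s j m : measurable (A s j m).
  have mexcess : measurable_fun setT (excess (h s j) (c s j) (tau m)).
    apply: measurable_sum => i; apply: measurable_maxr => //.
    apply: measurable_funB => //; apply: measurable_funM => //.
    apply: measurable_funX; apply: measurableT_comp => //.
    exact: measurableT_comp.
  rewrite /A -[X in measurable X]setTI.
  by apply: (measurable_fun_ltr (measurable_cst _) mexcess).
have mBs : forall k, measurable (Bs k).
  by move=> k; apply: bigsetU_measurable => j _; apply: bigsetU_measurable => m _; exact: mA.
have PA s j m : (m < N)%N -> (P (A s j m.+1) <= (expR (- t s m.+1))%:E)%E.
  move=> mN; apply: le_trans (truncated_sum_tail iidX (tau m.+1) (t s m.+1)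
    (mh s j) (hc s j)).
  rewrite [leRHS](_ : _ = P (A s j m.+1))//; congr (P _).
  have -> : 2 * N%:R * expR (- tau m.+1) = 2 * m.+1%:R :> R.
    rewrite /tau -lnV ?posrE ?divr_gt0 ?ltr0n// invf_div lnK; last first.
      by rewrite posrE divr_gt0 ?ltr0n.
    by rewrite -mulrA (mulrC N%:R) divfK// pnatr_eq0 -lt0n.
  by [].
have PA' s j m : (m < N)%N -> (P (A s j m.+1) <=
    (N%:R^-1 * (expR (- q - u ^+ 2) * expR (- (8 * (2 ^ s)%:R))))%:E)%E.
  move=> mN; apply: le_trans (PA s j m mN) _; rewrite lee_fin.
  have N0' : 0 < N%:R :> R by rewrite ltr0n.
  have -> : N%:R^-1 = expR (- ln N%:R) :> R by rewrite expRN lnK.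
  rewrite -!expRD ler_expR /t.
  have s1 : 1 <= (2 ^ s)%:R :> R by rewrite ler1n expn_gt0.
  have mN' : (0 < m.+1 <= N)%N by [].
  have := mlog_ge_ln R mN'; have := mlog_ge1 R mN'; have := sqr_ge0 u.
  move: (mlog N m.+1) (u ^+ 2) (ln _) ((2 ^ s)%:R) s1 => L v x z; nra.
have PBs s : (P (Bs s) <= (expR (- q - u ^+ 2) * 2^-1 ^+ s.+1)%:E)%E.
  have mBj j : measurable (\big[setU/set0]_(m < N) A s j m.+1).
    by apply: bigsetU_measurable => m _; exact: mA.
  have PBj j : (P (\big[setU/set0]_(m < N) A s j m.+1) <=
      (expR (- q - u ^+ 2) * expR (- (8 * (2 ^ s)%:R)))%:E)%E.
    apply: le_trans (measure_bigsetU_le (fun m _ => mA s j m.+1) (PA' s j)) _.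
    by rewrite mulVKf// pnatr_eq0 -lt0n.
  apply: le_trans (measure_bigsetU_le (fun j _ => mBj j) (fun j _ => PBj j)) _.
  rewrite lee_fin mulrCA ler_pM2l ?expR_gt0//.
  apply: le_trans (expR_level_le R s).
  by rewrite ler_pM2r ?expR_gt0// ler_nat.
exists (\bigcup_k Bs k); split.
- exact: bigcup_measurable.
- have mB : measurable (\bigcup_k Bs k) by exact: bigcup_measurable.
  apply: le_trans (measure_sigma_subadditive P mBs mB (@subset_refl _ _)) _.
  apply: (@le_trans _ _ (\sum_(0 <= s <oo)
      (expR (- q - u ^+ 2) * 2^-1 ^+ s.+1)%:E)%E).
    by apply: lee_nneseries => // s _; exact: PBs.
  apply: lime_le; first by apply: is_cvg_nneseries => s _ _; rewrite lee_fin
    mulr_ge0 ?expR_ge0// exprn_ge0.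
  apply: nearW => n; rewrite sumEFin lee_fin -mulr_sumr.
  by rewrite ler_piMr ?expR_ge0// geometric_half_le1.
- move=> w Bw s j I jM I0; apply: sum_subset_le => //; first by case: (hc s j).
  rewrite leNgt; apply/negP => wA; apply: Bw; exists s => //.
  have IN : (#|I| <= N)%N by rewrite -[X in (_ <= X)%N]card_ord max_card.
  rewrite /Bs -(bigcup_mkord (M s)
    (fun j => \big[setU/set0]_(m < N) A s j m.+1)); exists j => //.
  rewrite -(bigcup_mkord N (fun m => A s j m.+1)).
  by exists #|I|.-1; rewrite /= prednK.
Qed.

End UniformBound.

(** * Generic chaining *)

(** The enumeration may repeat the default [a]: nets need only be covered. *)
Lemma card_le_enum (V : Type) (A : set V) (B : set nat) (a : V) : (A #<= B)%card ->
  exists e : nat -> V, (forall j, e j = a \/ A (e j)) /\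
    forall x, A x -> exists2 j, B j & e j = x.
Proof.
move=> /pcard_leP[f].
exists (fun j => if pselect (exists2 x, A x & f x = j) is left h
                 then sval (cid2 h) else a); split.
  move=> j; case: pselect => [h|_]; last by left.
  by right; case: (cid2 h).
move=> x Ax; exists (f x); first exact: funS.
case: pselect => [h|]; last by case; exists x.
case: (cid2 h) => y Ay fyx /=; apply: (inj (f := f)) => //; exact: mem_set.
Qed.

(** The triangle inequality in the squared form of the subset bounds, from
    [(x + y) ^ 2 <= (1 + b / a) x ^ 2 + (1 + a / b) y ^ 2]. *)
Lemma l2_normD (R : realFieldType) (I : finType) (A : {set I}) (x y : I -> R)
    (a b : R) : 0 < a -> 0 < b ->
  \sum_(i in A) x i ^+ 2 <= a ^+ 2 -> \sum_(i in A) y i ^+ 2 <= b ^+ 2 ->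
  \sum_(i in A) (x i + y i) ^+ 2 <= (a + b) ^+ 2.
Proof.
move=> a0 b0 xa yb.
have ba0 : 0 <= 1 + b / a by rewrite addr_ge0// divr_ge0// ltW.
have ab0 : 0 <= 1 + a / b by rewrite addr_ge0// divr_ge0// ltW.
apply: (@le_trans _ _ (\sum_(i in A) ((1 + b / a) * x i ^+ 2 +
                                      (1 + a / b) * y i ^+ 2))).
  apply: ler_sum => i _; rewrite -subr_ge0.
  have -> : (1 + b / a) * x i ^+ 2 + (1 + a / b) * y i ^+ 2 - (x i + y i) ^+ 2 =
            (b * x i - a * y i) ^+ 2 / (a * b).
    by field; rewrite !gt_eqF.
  by rewrite divr_ge0 ?sqr_ge0// mulr_ge0 ?ltW.
rewrite big_split/= -!mulr_sumr.
apply: (@le_trans _ _ ((1 + b / a) * a ^+ 2 + (1 + a / b) * b ^+ 2)).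
  by apply: lerD; apply: ler_wpM2l.
by rewrite le_eqVlt; apply/orP; left; apply/eqP; field; rewrite !gt_eqF.
Qed.

Section Levels.
Context (R : realType).

Definition sqrt2pow (s : nat) : R := 2 `^ (s%:R / 2).

Lemma sqrt2pow_gt0 s : 0 < sqrt2pow s.
Proof. by rewrite powR_gt0. Qed.

Lemma sqrt2powK s : sqrt2pow s ^+ 2 = (2 ^ s)%:R.
Proof.
by rewrite /sqrt2pow -powR_mulrn ?powR_ge0// -powRrM divfK// powR_mulrn// natrX.
Qed.

Lemma sqrt2pow_leS s : sqrt2pow s <= sqrt2pow s.+1.
Proof. by rewrite ler_powR ?ler1n// ler_pM2r// ler_nat. Qed.

Lemma sqrt2pow_le s : sqrt2pow s <= 2 ^+ s.
Proof.
by rewrite -powR_mulrn// ler_powR ?ler1n// ler_pdivrMr// ler_peMr// ler1n.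
Qed.

(** The level at which nets of [2 ^ (2 ^ s)] points reach the size [exp V]. *)
Lemma level_exists (V : R) : 1 <= V ->
  exists s : nat, V <= (2 ^ s)%:R /\ (2 ^ s)%:R <= 2 * V.
Proof.
move=> V1.
have ex : exists s : nat, V <= (2 ^ s)%:R.
  exists (Num.bound V); apply: le_trans (ltW (archi_boundP _)) _.
    exact: le_trans V1.
  by rewrite ler_nat ltnW// ltn_expl.
case: (ex_minnP ex) => s sV smin; exists s; split=> //.
case: s sV smin => [|s] sV smin; first by rewrite expn0; lra.
rewrite expnS natrM ler_pM2l// leNgt; apply/negP => Vs.
by have := smin _ (ltW Vs); rewrite ltnn.
Qed.

End Levels.

(** The nets of the chaining: to an enumeration [e s] of the [s]-th set of an
    admissible sequence are added the zero function [z], where chains begin, and the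
    first [s + 1] functions of a countable family [g], where chains end. *)
Definition chain_net (V : Type) (z : V) (g : nat -> V) (e : nat -> nat -> V)
    (s j : nat) : V :=
  if j is j'.+1 then if (j' <= s)%N then g j' else e s (j' - s.+1)%N else z.

Definition net_size (s : nat) : nat := (2 ^ (2 ^ s) + s.+2)%N.

Lemma net_size_gt0 s : (0 < net_size s)%N.
Proof. by rewrite /net_size addnS. Qed.

Lemma net_size_le s : (net_size s.+1 * net_size s <= 2 ^ (5 * 2 ^ s))%N.
Proof.
have size_le k : (net_size k <= 2 ^ (2 ^ k).+1)%N.
  rewrite /net_size expnS mul2n -addnn leq_add2l.
  case: k => // k; apply: (@leq_trans (2 ^ k.+1).+1).
    by rewrite ltnS ltn_expl.
  by rewrite ltn_expl.
apply: (leq_trans (leq_mul (size_le s.+1) (size_le s))).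
rewrite -expnD leq_exp2l// expnS.
have : (0 < 2 ^ s)%N by rewrite expn_gt0.
by move: (2 ^ s)%N => m; rewrite !mul2n -!addnn; lia.
Qed.

Section ChainSum.
Context (R : realType) (N : nat).

(** The chain begins at the level [s0] with [V <= 2 ^ s0 <= 2 V]: from there on the
    factor [sqrt (2 ^ s)] absorbs [sqrt V], and the link from zero into the nets, of
    cost at most [2 D], is charged only [sqrt (2 ^ s0)], that is [sqrt V]. *)
Lemma chain_sum_le (I : {set 'I_N}) (x : nat -> 'I_N -> R) (c : nat -> R)
    (V kappa D E : R) : 1 <= V -> 0 < kappa -> 0 < D -> (forall s, 0 < c s) ->
  (forall s, V <= (2 ^ s)%:R -> \sum_(i in I) x s.+1 i ^+ 2 <=
     (kappa * sqrt2pow R s * (2 * D)) ^+ 2) ->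
  (forall s, V <= (2 ^ s)%:R -> \sum_(i in I) (x s.+1 i - x s i) ^+ 2 <=
     (kappa * sqrt2pow R s * c s) ^+ 2) ->
  (forall n, \sum_(0 <= s < n) sqrt2pow R s * c s <= E) ->
  exists s1, forall s, (s1 <= s)%N ->
    \sum_(i in I) x s i ^+ 2 <= 2 * kappa ^+ 2 * (8 * D ^+ 2 * V + E ^+ 2).
Proof.
move=> V1 k0 D0 c0 start link sumc; have [s0 [Vs0 s0V]] := level_exists V1.
have b0 := @sqrt2pow_gt0 R.
have E0 : 0 <= E by have := sumc 0%N; rewrite big_nil.
have claim k : \sum_(i in I) x (s0.+1 + k)%N i ^+ 2 <=
    (kappa * (sqrt2pow R s0 * (2 * D) +
      \sum_(s0.+1 <= s < s0.+1 + k) sqrt2pow R s * c s)) ^+ 2.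
  elim: k => [|k IHk].
    by rewrite addn0 big_geq// addr0 mulrA; exact: start.
  rewrite addnS big_nat_recr ?leq_addr//= [_ + (_ + _)]addrA [kappa * (_ + _)]mulrDr.
  have tel i : x (s0.+1 + k).+1 i =
      x (s0.+1 + k)%N i + (x (s0.+1 + k).+1 i - x (s0.+1 + k)%N i).
    by rewrite addrC subrK.
  under eq_bigr do rewrite tel.
  apply: l2_normD => //.
  - rewrite mulr_gt0// ltr_wpDr ?sumr_ge0//; last first.
      by rewrite mulr_gt0 ?b0 ?mulr_gt0.
    by move=> s _; rewrite mulr_ge0 ?ltW.
  - by rewrite !mulr_gt0.
  - rewrite mulrA; apply: link; apply: le_trans Vs0 _.
    by rewrite ler_nat leq_exp2l// addSn ltnW// ltnS leq_addr.
exists s0.+1 => s s0s; rewrite -(subnKC s0s); apply: le_trans (claim _) _.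
set S := \sum_(_ <= _ < _) _.
have S0 : 0 <= S by apply: sumr_ge0 => j _; rewrite mulr_ge0 ?ltW.
have SE : S <= E.
  apply: le_trans (sumc (s0.+1 + (s - s0.+1))%N).
  rewrite [leRHS](big_cat_nat (n := s0.+1))//= ?leq_addr// lerDr.
  by apply: sumr_ge0 => j _; rewrite mulr_ge0 ?ltW.
have bV : sqrt2pow R s0 ^+ 2 <= 2 * V by rewrite sqrt2powK.
rewrite exprMn -[leRHS]mulrA [leRHS]mulrCA ler_wpM2l ?sqr_ge0//.
have SE2 : S ^+ 2 <= E ^+ 2 by rewrite lerXn2r.
have bD : sqrt2pow R s0 ^+ 2 * D ^+ 2 <= 2 * V * D ^+ 2.
  by rewrite ler_wpM2r ?sqr_ge0.
have := sqr_ge0 (sqrt2pow R s0 * (2 * D) - S).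
by move: SE2 bD; rewrite !expr2; nra.
Qed.

End ChainSum.

Section ClassBound.
Context (dW d : measure_display) (W : measurableType dW) (T : measurableType d)
        (R : realType).
Variables (P : probability W R) (mu : probability T R) (N : nat)
          (X : 'I_N -> {RV P >-> T}).
Hypothesis iidX : iid_with_law mu X.

Lemma psi2_diam_ub (F : set (T -> R)) f : F f -> (psi2_norm mu f <= psi2_diam mu F)%E.
Proof. by move=> Ff; apply: ereal_sup_ubound; exists f. Qed.

Lemma psi2_distC (f g : T -> R) : measurable_fun setT f -> measurable_fun setT g ->
  (psi2_norm mu (f - g)%R <= psi2_norm mu (g - f)%R)%E.
Proof.
move=> mf mg; apply: le_psi2_norm; try exact: measurable_funB.
by move=> x; rewrite (_ : (f - g) x = - (g x - f x)) ?normrN// opprB.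
Qed.

Lemma psi2_normB (f g : T -> R) : measurable_fun setT f -> measurable_fun setT g ->
  (psi2_norm mu (f - g)%R <= psi2_norm mu f + psi2_norm mu g)%E.
Proof.
move=> mf mg; have mNg : measurable_fun setT (- g) by exact: measurableT_comp.
apply: le_trans (psi2_normD mu mf mNg) _; apply: leeD => //.
by apply: le_psi2_norm => // x; rewrite normrN.
Qed.

(** The infimum over admissible sequences need not be attained; the excess [D] is
    affordable because [D] is at most twice gamma in the end. *)
Lemma near_optimal_admissible (F : set (T -> R)) (D G : R) : F !=set0 -> 0 < D ->
  (forall f, F f -> measurable_fun setT f) ->
  psi2_diam mu F = D%:E -> gamma_psi2 mu F = G%:E ->
  exists (A : nat -> set (T -> R)) (e : nat -> nat -> T -> R),
  [/\ forall s j, F (e s j),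
      forall s f, A s f -> exists2 j, (j < 2 ^ (2 ^ s))%N & e s j = f,
      forall f s, F f -> dist_to_set (psi2_dist mu) f (A s) \is a fin_num &
      forall f n, F f -> \sum_(0 <= s < n)
        sqrt2pow R s * fine (dist_to_set (psi2_dist mu) f (A s)) <= G + D].
Proof.
move=> [f0 Ff0] D0 mF FD FG.
have [_ [A [[a A0] cardA incA AF _] <-] supA] :
    exists2 x, [set ereal_sup [set (\sum_(0 <= s <oo)
      ((2 `^ (s%:R / 2))%:E * dist_to_set (psi2_dist mu) x (A s)))%E | x in F]
      | A in admissible_seq (psi2_dist mu) F] x & (x < (G + D)%:E)%E.
  apply: ereal_inf_lt; apply: (@le_lt_trans _ _ G%:E); first by rewrite -FG.
  by rewrite lte_fin ltrDl.
have Aa s : A s a by elim: s => [|s /incA//]; rewrite A0.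
have Fa : F a by exact: AF (Aa 0%N).
have enumA s : exists e : nat -> T -> R, (forall j, F (e j)) /\
    forall f, A s f -> exists2 j, (j < 2 ^ (2 ^ s))%N & e j = f.
  case: s => [|s].
    by exists (fun=> a); split=> // f; rewrite A0 => ->; exists 0%N.
  have [e [eA Ae]] := card_le_enum a (cardA s.+1 isT).
  by exists e; split=> // j; case: (eA j) => [->//|/AF].
have [e eP] := choice enumA.
have fin f s : F f -> dist_to_set (psi2_dist mu) f (A s) \is a fin_num.
  move=> Ff; rewrite ge0_fin_numE ?dist_to_set_ge0//.
  apply: (@le_lt_trans _ _ (psi2_dist mu f a)).
    by apply: ereal_inf_lbound; exists a.
  apply: le_lt_trans (psi2_normB (mF _ Ff) (mF _ Fa)) _.
  apply: le_lt_trans (leeD (psi2_diam_ub Ff) (psi2_diam_ub Fa)) _.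
  by rewrite FD -EFinD ltry.
exists A, e; split => //.
- by move=> s j; case: (eP s).
- by move=> s f; case: (eP s) => _; exact.
move=> f n Ff; rewrite -lee_fin; apply: le_trans _ (ltW supA).
apply: le_ereal_sup_tmp; eexists; first by exists f => //; reflexivity.
rewrite -sumEFin; under eq_bigr do rewrite EFinM fineK ?fin//.
apply: nneseries_lim_ge => s _ _.
by rewrite mule_ge0// ?dist_to_set_ge0// lee_fin powR_ge0.
Qed.

(** The truncation at level [log (N / m)] makes a subset of size [m] cost [mlog N m],
    and chaining along an almost optimal admissible sequence costs [G + D].  Chains end
    in a countable family that separability makes dense in the class on the sample. *)
Lemma class_subset_bound (F : set (T -> R)) (q u D G : R) : (0 < N)%N -> 0 <= q ->
  0 < D -> 0 <= G -> F !=set0 -> (forall f, F f -> measurable_fun setT f) ->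
  separable_class X F -> psi2_diam mu F = D%:E -> gamma_psi2 mu F = G%:E ->
  exists B : set W, [/\ measurable B, (P B <= (expR (- q - u ^+ 2))%:E)%E &
    forall w, ~ B w -> forall f (I : {set 'I_N}), F f -> (0 < #|I|)%N ->
      \sum_(i in I) f (X i w) ^+ 2 <=
      200 * (18 + 2 * q) * ((G + D) ^+ 2 + D ^+ 2 * (mlog N #|I| + u ^+ 2))].
Proof.
move=> N0 q0 D0 G0 F0 mF [S [cS SF] sepS] FD FG.
have [A [e [Fe Ae fin sumA]]] := near_optimal_admissible F0 D0 mF FD FG.
case: F0 => a Fa.
have [g [ga gS]] := card_le_enum a cS.
have Fg n : F (g n) by case: (ga n) => [->//|/SF].
pose net := chain_net (0 : T -> R) g e.
have F0net s j : net s j = 0 \/ F (net s j).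
  by rewrite /net /chain_net; case: j => [|j]; [left|right; case: ifP].
have mnet s j : measurable_fun setT (net s j).
  by case: (F0net s j) => [->|/mF//]; exact: measurable_cst.
have Dnet s j : (psi2_norm mu (net s j) <= D%:E)%E.
  case: (F0net s j) => [->|/psi2_diam_ub]; last by rewrite FD.
  by rewrite psi2_norm0 lee_fin ltW.
(* The norms are infima, so the cost of a link must exceed its norm; the excess [eps]
   decays fast enough to be summable against [sqrt2pow]. *)
pose eps s : R := D * 2^-1 ^+ (s + s).+1.
have eps0 s : 0 < eps s by rewrite mulr_gt0// exprn_gt0.
have epsD s : eps s <= D.
  by rewrite ler_piMr ?(ltW D0)// exprn_ile1// invf_le1// ler1n.
have eps_sum n : \sum_(0 <= s < n) sqrt2pow R s * eps s <= D.
  apply: (@le_trans _ _ (D * \sum_(0 <= s < n) 2^-1 ^+ s.+1)).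
    rewrite mulr_sumr; apply: ler_sum => s _; rewrite mulrCA ler_pM2l//.
    apply: (@le_trans _ _ (2 ^+ s * 2^-1 ^+ (s + s).+1)).
      by rewrite ler_wpM2r ?exprn_ge0// sqrt2pow_le.
    by rewrite -addnS exprD mulrA -exprMn divff// expr1n mul1r.
  by rewrite ler_piMr ?(ltW D0)// geometric_half_le1.
pose cost s (f f' : T -> R) := fine (psi2_norm mu (f - f')) + eps s.
have cost0 s f f' : 0 < cost s f f'.
  by rewrite ltr_wpDl// fine_ge0// psi2_norm_ge0.
have finB s s' j j' : psi2_norm mu (net s j - net s' j')%R \is a fin_num.
  rewrite ge0_fin_numE ?psi2_norm_ge0//.
  apply: le_lt_trans (psi2_normB (mnet _ _) (mnet _ _)) _.
  by apply: le_lt_trans (leeD (Dnet _ _) (Dnet _ _)) _; rewrite -EFinD ltry.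
pose h s k := net s.+1 (k %/ net_size s)%N - net s (k %% net_size s)%N.
pose c s k := cost s (net s.+1 (k %/ net_size s)%N) (net s (k %% net_size s)%N).
have mh s k : measurable_fun setT (h s k) by exact: measurable_funB.
have hc s k : subgauss mu (h s k) (c s k).
  apply: psi2_norm_lt; first exact: mh.
  by rewrite -[ltLHS]fineK ?finB// lte_fin ltrDl.
have [B [mB PB HB]] := uniform_subset_bound iidX u N0 q0 net_size_le mh hc.
have link w s j j' (I : {set 'I_N}) : ~ B w -> (j < net_size s.+1)%N ->
    (j' < net_size s)%N -> (0 < #|I|)%N ->
    \sum_(i in I) (net s.+1 j (X i w) - net s j' (X i w)) ^+ 2 <=
    cost s (net s.+1 j) (net s j') ^+ 2 *
    (2 * mlog N #|I| + (8 + q) * ((2 ^ s)%:R + mlog N #|I| + u ^+ 2)).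
  move=> Bw js j's I0.
  have jj' : (j * net_size s + j' < net_size s.+1 * net_size s)%N.
    apply: (@leq_trans (j * net_size s + net_size s)); first by rewrite ltn_add2l.
    by rewrite -mulSnr leq_mul2r js orbT.
  have := HB w Bw s _ I jj' I0; rewrite /h /c.
  by rewrite divnMDl ?net_size_gt0// divn_small// addn0 modnMDl modn_small.
case: sepS => Z [mZ PZ0 HZ].
exists (B `|` Z); split.
- exact: measurableU.
- apply: le_trans (measureU2 P mB mZ) _; rewrite [X in (_ + X)%E]PZ0 adde0; exact: PB.
move=> w /not_orP[Bw Zw] f I Ff I0.
have {HZ}sepw := contrapT (fun h => Zw (HZ w h)).
have IN : (0 < #|I| <= N)%N by rewrite I0 -[X in (_ <= X)%N]card_ord max_card.
set L := mlog N #|I| in link *.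
have L1 : 1 <= L by exact: mlog_ge1.
pose V := L + u ^+ 2; have LV : L <= V by rewrite lerDl sqr_ge0.
have V1 : 1 <= V by exact: le_trans LV.
(* [18 + 2 q] bounds [(2 L + (8 + q) (2 ^ s + V)) / 2 ^ s] once [L <= V <= 2 ^ s]. *)
have q18 : 0 < 18 + 2 * q by rewrite ltr_wpDr ?mulr_ge0.
pose kappa := Num.sqrt (18 + 2 * q).
have kappaK : kappa ^+ 2 = 18 + 2 * q by rewrite sqr_sqrtr// ltW.
have kappa0 : 0 < kappa by rewrite sqrtr_gt0.
have link' s j j' : V <= (2 ^ s)%:R -> (j < net_size s.+1)%N ->
    (j' < net_size s)%N ->
    \sum_(i in I) (net s.+1 j (X i w) - net s j' (X i w)) ^+ 2 <=
    (kappa * sqrt2pow R s * cost s (net s.+1 j) (net s j')) ^+ 2.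
  move=> Vs js j's; apply: le_trans (link w s j j' I Bw js j's I0) _.
  rewrite !exprMn kappaK sqrt2powK [leRHS]mulrC ler_wpM2l ?sqr_ge0//.
  move: Vs LV; rewrite -/L /V; move: (u ^+ 2) ((2 ^ s)%:R) => v t; nra.
pose M := 2 * kappa ^+ 2 * (8 * D ^+ 2 * V + (2 * G + 5 * D) ^+ 2).
have gM n : \sum_(i in I) g n (X i w) ^+ 2 <= M.
  pose r s := fine (dist_to_set (psi2_dist mu) (g n) (A s)) + eps s.
  have r0 s : 0 <= r s.
    by rewrite addr_ge0 ?(ltW (eps0 s))// fine_ge0// dist_to_set_ge0.
  have near_point s : exists j, [/\ (j < net_size s)%N,
      (psi2_norm mu (g n - net s j)%R <= (r s)%:E)%E & (n <= s)%N -> net s j = g n].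
    have [ns|sn] := leqP n s.
      have gnE : net s n.+1 = g n by rewrite /net /chain_net ns.
      exists n.+1; split=> //.
        by rewrite /net_size addnS ltnS (leq_trans (_ : _ <= s.+1)%N) ?leq_addl.
      by rewrite gnE subrr psi2_norm0 lee_fin.
    have : (dist_to_set (psi2_dist mu) (g n) (A s) < (r s)%:E)%E.
      by rewrite -[ltLHS]fineK ?fin// lte_fin ltrDl.
    move=> /ereal_inf_lt[_ [f' Af' <-] fr].
    have [j jlt jE] := Ae _ _ Af'.
    have netE : net s (j + s.+2)%N = f'.
      by rewrite /net /chain_net addnS leqNgt leq_addl/= addnK.
    exists (j + s.+2)%N; split.
    - by rewrite ltn_add2r.
    - by rewrite netE; exact: ltW.
    - by [].
  have [js jsP] := choice near_point.
  pose pi s := net s (js s).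
  have pi_size s : (js s < net_size s)%N by case: (jsP s).
  have pi_dist s : (psi2_norm mu (g n - pi s)%R <= (r s)%:E)%E by case: (jsP s).
  have mg : measurable_fun setT (g n) by exact: mF.
  have mpi s : measurable_fun setT (pi s) by exact: mnet.
  have cost_le s : cost s (pi s.+1) (pi s) <= r s.+1 + r s + eps s.
    rewrite lerD2r -lee_fin fineK ?finB//.
    have -> : pi s.+1 - pi s = (pi s.+1 - g n) + (g n - pi s) by rewrite addrA subrK.
    have m1 : measurable_fun setT (pi s.+1 - g n) by exact: measurable_funB.
    have m2 : measurable_fun setT (g n - pi s) by exact: measurable_funB.
    apply: le_trans (psi2_normD mu m1 m2) _; rewrite EFinD; apply: leeD => //.
    by apply: le_trans (pi_dist s.+1); exact: psi2_distC.
  have r_sum k : \sum_(0 <= s < k) sqrt2pow R s * r s <= G + 2 * D.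
    under eq_bigr do rewrite mulrDr; rewrite big_split/=.
    have := sumA (g n) k (Fg n); have := eps_sum k; lra.
  have r_sumS k : \sum_(0 <= s < k) sqrt2pow R s * r s.+1 <= G + 2 * D.
    apply: le_trans (r_sum k.+1); rewrite [leRHS]big_nat_recl//=.
    rewrite ler_wpDl ?mulr_ge0 ?(ltW (sqrt2pow_gt0 _ _))//.
    by apply: ler_sum => s _; rewrite ler_wpM2r ?sqrt2pow_leS.
  have cost_sum k :
      \sum_(0 <= s < k) sqrt2pow R s * cost s (pi s.+1) (pi s) <= 2 * G + 5 * D.
    apply: (@le_trans _ _ (\sum_(0 <= s < k) (sqrt2pow R s * r s.+1 +
        sqrt2pow R s * r s + sqrt2pow R s * eps s))).
      apply: ler_sum => s _; rewrite -!mulrDr ler_pM2l ?sqrt2pow_gt0//.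
    rewrite !big_split/=.
    have := r_sumS k; have := r_sum k; have := eps_sum k; lra.
  have cost_pi0 s : cost s (pi s.+1) (net s 0) <= 2 * D.
    rewrite mulrDl mul1r lerD// -lee_fin fineK ?finB//.
    by rewrite /net /= subr0; exact: Dnet.
  have start s : V <= (2 ^ s)%:R -> \sum_(i in I) pi s.+1 (X i w) ^+ 2 <=
      (kappa * sqrt2pow R s * (2 * D)) ^+ 2.
    move=> Vs.
    have := link' s _ 0%N Vs (pi_size s.+1) (net_size_gt0 s).
    under eq_bigr do rewrite subr0.
    move/le_trans; apply; rewrite lerXn2r ?nnegrE//.
    - by rewrite !mulr_ge0 ?(ltW kappa0) ?(ltW (cost0 _ _ _)) ?(ltW (sqrt2pow_gt0 _ _)).
    - by rewrite !mulr_ge0 ?(ltW kappa0) ?(ltW D0) ?(ltW (sqrt2pow_gt0 _ _)).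
    - by rewrite ler_wpM2l ?cost_pi0// mulr_ge0 ?(ltW kappa0) ?(ltW (sqrt2pow_gt0 _ _)).
  have [s1 s1P] := @chain_sum_le R N I (fun s i => pi s (X i w))
    (fun s => cost s (pi s.+1) (pi s)) V kappa D (2 * G + 5 * D) V1 kappa0 D0
    (fun s => cost0 _ _ _) start
    (fun s Vs => link' s _ _ Vs (pi_size _) (pi_size _)) cost_sum.
  have := s1P (maxn s1 n) (leq_maxl _ _).
  by rewrite /pi; case: (jsP (maxn s1 n)) => _ _ ->//; exact: leq_maxr.
(* On the sample [f] lies within [t] of some [g n], and [N t ^ 2 = M]: the error
   doubles the norm and needs no limit. *)
have M0 : 0 < M.
  rewrite mulr_gt0 ?mulr_gt0 ?exprn_gt0// ltr_wpDr ?sqr_ge0//.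
  by rewrite !mulr_gt0 ?exprn_gt0// (lt_le_trans _ V1).
have N0' : 0 < N%:R :> R by rewrite ltr0n.
pose t := Num.sqrt (M / N%:R).
have t0 : 0 < t by rewrite sqrtr_gt0 divr_gt0.
have [_ /gS[n _ <-] fg] := sepw f Ff t t0.
have sM : Num.sqrt M ^+ 2 = M by rewrite sqr_sqrtr// ltW.
have fgM : \sum_(i in I) (f (X i w) - g n (X i w)) ^+ 2 <= Num.sqrt M ^+ 2.
  apply: (@le_trans _ _ (\sum_(i in I) t ^+ 2)).
    apply: ler_sum => i _; rewrite -real_normK ?num_real// distrC lerXn2r ?nnegrE ?(ltW t0)//.
    exact: ltW.
  have -> : t ^+ 2 = M / N%:R by rewrite sqr_sqrtr// divr_ge0 ?(ltW M0).
  rewrite sumr_const -[leLHS]mulr_natl sM.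
  rewrite mulrA ler_pdivrMr// mulrC ler_pM2l// ler_nat.
  by case/andP: IN.
have sM0 : 0 < Num.sqrt M by rewrite sqrtr_gt0.
have gsM : \sum_(i in I) g n (X i w) ^+ 2 <= Num.sqrt M ^+ 2 by rewrite sM.
have := l2_normD sM0 sM0 gsM fgM.
under eq_bigr do rewrite addrC subrK.
move=> /le_trans; apply.
have -> : (Num.sqrt M + Num.sqrt M) ^+ 2 = 4 * M.
  by rewrite -[in RHS]sM; ring.
rewrite /M kappaK -/V.
have -> : 4 * (2 * (18 + 2 * q) * (8 * D ^+ 2 * V + (2 * G + 5 * D) ^+ 2)) =
   (18 + 2 * q) * (8 * (8 * D ^+ 2 * V + (2 * G + 5 * D) ^+ 2)) by ring.
rewrite -[leRHS]mulrA [leRHS]mulrCA ler_pM2l//.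
have VD : 0 <= V * D ^+ 2 by rewrite mulr_ge0 ?sqr_ge0// (le_trans _ V1).
have GD : 0 <= G * D by rewrite mulr_ge0// ltW.
have GG : 0 <= G ^+ 2 by exact: sqr_ge0.
rewrite !expr2 in VD GG *; nra.
Qed.

End ClassBound.

(** * From subsets to products *)

Section Deterministic.
Context (R : realType) (N : nat).
Hypothesis N0 : (0 < N)%N.

Section OneSequence.
Variables (y : 'I_N -> R) (K a : R).
Hypotheses (K0 : 0 < K) (a0 : 1 <= 4 * a).
Hypothesis yI : forall I : {set 'I_N}, (0 < #|I|)%N ->
  \sum_(i in I) y i <= K * (a + mlog N #|I|).

Local Notation lam := (1 + ln N%:R : R).

Lemma lam_ge1 : 1 <= lam.
Proof. by rewrite lerDl ln_ge0// ler1n. Qed.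

Lemma entry_le i : y i <= K * (a + lam).
Proof.
have := yI (I := [set i]%SET); rewrite cards1 big_set1 => /(_ isT).
by rewrite /mlog mul1r divr1.
Qed.

(** Let [m] entries exceed [t], with sum [T]; then [m t <= T <= K (a + m log (e N / m))].
    Either [log (e N / m) <= t / (2 K)] and half of [T] absorbs the last term, or [m]
    is at most [e N exp (- t / (2 K))]. *)
Lemma tail_sum_le (t : R) : 0 <= t ->
  \sum_(i | t < y i) y i <=
  2 * K * a + 2 * K * expR 1 * N%:R * expR (- (t / (4 * K))).
Proof.
move=> t0.
have e0 : 0 <= 2 * K * expR 1 * N%:R * expR (- (t / (4 * K))).
  by rewrite !mulr_ge0 ?expR_ge0 ?(ltW K0).
have age0 : 0 <= a by move: a0; lra.
have a0' : 0 <= 2 * K * a by rewrite !mulr_ge0 ?(ltW K0).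
pose E := [set i | t < y i]%SET.
have -> : \sum_(i | t < y i) y i = \sum_(i in E) y i.
  by apply: eq_bigl => i; rewrite inE.
have [E0|E0] := posnP #|E|.
  by rewrite (cards0_eq E0) big_set0 addr_ge0.
have mN : (0 < #|E| <= N)%N by rewrite E0 -[X in (_ <= X)%N]card_ord max_card.
have := yI E0; rewrite /mlog; set x := ln _; set T := \sum_(i in E) y i => TK.
have x0 : 0 <= x by exact: ln_div_ge0.
have m0 : 0 < #|E|%:R :> R by rewrite ltr0n.
have mT : #|E|%:R * t <= T.
  rewrite mulr_natl -sumr_const; apply: ler_sum => i.
  by rewrite inE => /ltW.
have [xt|xt] := leP (1 + x) (t / (2 * K)).
  have : K * (#|E|%:R * (1 + x)) <= #|E|%:R * t / 2.
    rewrite mulrCA -mulrA ler_pM2l//.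
    by move: xt; rewrite ler_pdivlMr ?mulr_gt0// => xt; nra.
  lra.
have mE : #|E|%:R = N%:R * expR (- x) :> R.
  have N0' : 0 < N%:R :> R by rewrite ltr0n.
  by rewrite expRN lnK ?posrE ?divr_gt0// invf_div mulrC divfK// gt_eqF.
have xe : (1 + x) * expR (- x) <= 2 * expR 1 * expR (- (t / (4 * K))).
  have h1 : 1 + x <= 2 * expR ((1 + x) / 2).
    have := expR_ge1Dx ((1 + x) / 2); lra.
  apply: (@le_trans _ _ (2 * expR ((1 + x) / 2) * expR (- x))).
    by rewrite ler_wpM2r ?expR_ge0.
  rewrite -!mulrA ler_pM2l// -!expRD ler_expR.
  move: xt; rewrite ltr_pdivrMr ?mulr_gt0// => xt.
  have : t / (4 * K) <= (1 + x) / 2.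
    rewrite ler_pdivrMr ?mulr_gt0//.
    by have -> : (1 + x) / 2 * (4 * K) = (1 + x) * (2 * K); [field|exact: ltW].
  lra.
apply: le_trans TK _; rewrite mulrDr; apply: lerD.
  by have := mulr_ge0 (ltW K0) age0; nra.
rewrite mE.
have -> : K * (N%:R * expR (- x) * (1 + x)) = K * N%:R * ((1 + x) * expR (- x)) by ring.
have -> : 2 * K * expR 1 * N%:R * expR (- (t / (4 * K))) =
          K * N%:R * (2 * expR 1 * expR (- (t / (4 * K)))) by ring.
by rewrite ler_wpM2l// mulr_ge0// ltW.
Qed.

(** At [t = 4 K lam] the second term of the tail bound is [2 K], and [1 <= 4 a]. *)
Lemma large_entries_sum_le : \sum_(i | 4 * K * lam < y i) y i <= 10 * K * a.
Proof.
have K4 : 0 < 4 * K by rewrite mulr_gt0.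
apply: le_trans (tail_sum_le _) _; first by rewrite mulr_ge0 ?ltW// (lt_le_trans _ lam_ge1).
have -> : 4 * K * lam / (4 * K) = lam by field; rewrite gt_eqF.
rewrite opprD expRD !expRN lnK ?posrE ?ltr0n//.
have -> : 2 * K * expR 1 * N%:R * ((expR 1)^-1 / N%:R) = 2 * K.
  by field; rewrite !gt_eqF ?expR_gt0 ?ltr0n.
have := ler_wpM2l (ltW K0) a0; lra.
Qed.

End OneSequence.

(** The sum telescopes over the [j] below [z]. *)
Lemma layer_cake n (J : nat) (z : R) : (0 < n)%N -> 0 <= z <= J%:R ->
  z ^+ n <= \sum_(j < J) (j.+1%:R ^+ n - j%:R ^+ n) * (j%:R < z)%R%:R.
Proof.
move=> n0; elim: J => [|J IHJ] /andP[z0 zJ].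
  have -> : z = 0 by apply/eqP; rewrite eq_le zJ z0.
  by rewrite expr0n gtn_eqF// big_ord0.
have [zJ'|zJ'] := leP z J%:R.
  rewrite big_ord_recr/= ltNge zJ' mulr0 addr0.
  by apply: IHJ; rewrite z0.
apply: (@le_trans _ _ (J.+1%:R ^+ n)); first by rewrite lerXn2r ?nnegrE.
under eq_bigr => j _.
  rewrite (_ : j%:R < z); last first.
    by apply: le_lt_trans zJ'; rewrite ler_nat -ltnS.
  rewrite mulr1; over.
rewrite -(big_mkord xpredT (fun j => j.+1%:R ^+ n - j%:R ^+ n)).
by rewrite telescope_sumr// expr0n gtn_eqF// subr0.
Qed.

Lemma sum_inv_sqr_le n : \sum_(j < n) (j.+1%:R ^+ 2)^-1 <= 2 :> R.
Proof.
case: n => [|n]; first by rewrite big_ord0.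
suff : \sum_(j < n.+1) (j.+1%:R ^+ 2)^-1 <= 2 - n.+1%:R^-1 :> R.
  by move/le_trans; apply; rewrite gerBl.
elim: n => [|n IHn]; first by rewrite big_ord_recl big_ord0 expr1n invr1; lra.
rewrite big_ord_recr/=.
apply: le_trans (lerD IHn (lexx _)) _.
have x0 : 0 < n.+1%:R :> R by [].
have -> : n.+2%:R = n.+1%:R + 1 :> R by rewrite natr1.
move: (n.+1%:R) x0 => x x0.
have x10 : 0 < x + 1 by rewrite ltr_wpDr.
have -> : 2 - (x + 1)^-1 = 2 - x^-1 + (x * (x + 1))^-1.
  by field; rewrite !gt_eqF.
rewrite lerD2l lef_pV2 ?posrE ?mulr_gt0 ?exprn_gt0//.
by rewrite expr2 ler_pM2r// lerDl.
Qed.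

Lemma expR_ge_pow (n : nat) (x : R) : 0 <= x -> x ^+ n <= n`!%:R * expR x.
Proof.
move=> x0; case: n => [|n].
  by rewrite expr0 fact0 mul1r (le_trans _ (expR_ge1Dx x))// lerDl.
rewrite -ler_pdivrMl ?ltr0n ?fact_gt0// mulrC.
by apply: le_trans (expR_ge1Dxn n x0); rewrite lerDr.
Qed.

Definition moderate_const (n : nat) : R :=
  4 ^+ n.+1 * (2 ^+ n + expR 1 ^+ 2 * n.+2`!%:R).

(** The layer-cake bound for the [n+1]-st powers of the entries below [4 K lam]: in
    units of [4 K], the sum of the entries above [j] is at most [a + N exp (- j)] up to
    constants, and [j] runs up to the order of [lam]. *)
Lemma moderate_entries_pow_le (n : nat) (y : 'I_N -> R) (K a : R) : (0 < n)%N ->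
  (forall i, 0 <= y i) -> 0 < K -> 1 <= 4 * a ->
  (forall I : {set 'I_N}, (0 < #|I|)%N ->
    \sum_(i in I) y i <= K * (a + mlog N #|I|)) ->
  \sum_(i | y i <= 4 * K * (1 + ln N%:R)) y i ^+ n.+1 <=
     moderate_const n * K ^+ n.+1 * (N%:R + a * (1 + ln N%:R) ^+ n).
Proof.
move=> n0 y0 K0 a0 yI; set lam := 1 + ln N%:R.
have lam1 : 1 <= lam by exact: lam_ge1.
have age0 : 0 <= a by move: a0; lra.
have K4 : 0 < 4 * K by rewrite mulr_gt0.
pose J := (Num.truncn lam).+1.
have /andP[Jlam lamJ] : (Num.truncn lam)%:R <= lam < J%:R.
  by apply: truncn_itv; exact: le_trans lam1.
have J2 : J%:R <= 2 * lam by rewrite /J -natr1; move: Jlam lam1; lra.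
pose D j : R := j.+1%:R ^+ n - j%:R ^+ n.
have D0 j : 0 <= D j by rewrite subr_ge0 lerXn2r ?nnegrE// ler_nat.
have -> : \sum_(i | y i <= 4 * K * lam) y i ^+ n.+1 =
    (4 * K) ^+ n.+1 * \sum_(i | y i <= 4 * K * lam) (y i / (4 * K)) ^+ n.+1.
  rewrite mulr_sumr; apply: eq_bigr => i _.
  by rewrite -exprMn mulrC divfK ?gt_eqF.
have tail j : \sum_(i | j%:R < y i / (4 * K)) y i / (4 * K) <=
    a / 2 + expR 1 / 2 * N%:R * expR (- j%:R).
  have := tail_sum_le K0 a0 yI (t := 4 * K * j%:R).
  rewrite mulr_ge0 ?(ltW K4)// => /(_ isT).
  have -> : 4 * K * j%:R / (4 * K) = j%:R by field; rewrite gt_eqF.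
  rewrite -mulr_suml ler_pdivrMr// => h.
  under eq_bigl do rewrite ltr_pdivlMr// mulrC.
  apply: le_trans h _; rewrite le_eqVlt; apply/orP; left; apply/eqP; by field.
pose c : R := 2 ^+ n + expR 1 ^+ 2 * n.+2`!%:R.
have -> : moderate_const n * K ^+ n.+1 * (N%:R + a * lam ^+ n) =
    (4 * K) ^+ n.+1 * (c * (N%:R + a * lam ^+ n)).
  by rewrite exprMn /moderate_const -/c; ring.
rewrite ler_pM2l ?exprn_gt0//.
apply: (@le_trans _ _ (\sum_(j < J) D j *
    \sum_(i | j%:R < y i / (4 * K)) y i / (4 * K))).
  under [leRHS]eq_bigr do rewrite big_mkcond mulr_sumr.
  rewrite exchange_big/= [leLHS]big_mkcond/=.
  apply: ler_sum => i _; have z0 : 0 <= y i / (4 * K) by rewrite divr_ge0 ?(ltW K4).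
  case: ifP => [ylam|_]; last first.
    apply: sumr_ge0 => j _; rewrite mulr_ge0 //; case: ifP => //.
  have zJ : 0 <= y i / (4 * K) <= J%:R.
    by rewrite z0 (le_trans _ (ltW lamJ))// ler_pdivrMr// mulrC.
  rewrite exprS; apply: le_trans (ler_wpM2l z0 (layer_cake n0 zJ)) _.
  rewrite mulr_sumr; apply: ler_sum => j _; rewrite mulrCA.
  apply: ler_wpM2l; first exact: D0.
  by case: ifP => _; rewrite ?mulr1 ?mulr0.
apply: (@le_trans _ _ (\sum_(j < J) (a / 2 * D j +
    expR 1 ^+ 2 * n.+2`!%:R / 2 * N%:R * (j.+1%:R ^+ 2)^-1))).
  apply: ler_sum => j _; apply: le_trans (ler_wpM2l (D0 j) (tail j)) _.
  rewrite mulrDr [D j * _]mulrC lerD2l.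
  have DE : D j * expR (- j%:R) <= expR 1 * n.+2`!%:R / j.+1%:R ^+ 2.
    rewrite ler_pdivlMr ?exprn_gt0//.
    apply: (@le_trans _ _ (j.+1%:R ^+ n.+2 * expR (- j%:R))).
      have -> : j.+1%:R ^+ n.+2 = j.+1%:R ^+ n * j.+1%:R ^+ 2 :> R.
        by rewrite -exprD addn2.
      rewrite mulrAC ler_wpM2r ?expR_ge0// ler_wpM2r ?sqr_ge0//.
      by rewrite gerBl exprn_ge0.
    rewrite expRN ler_pdivrMr ?expR_gt0//.
    apply: le_trans (expR_ge_pow _ _) _ => //.
    rewrite -natr1 expRD le_eqVlt; apply/orP; left; apply/eqP; ring.
  have e0 : 0 <= expR 1 / 2 * N%:R :> R by rewrite mulr_ge0// divr_ge0 ?expR_ge0.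
  have := ler_wpM2l e0 DE.
  have -> : expR 1 / 2 * N%:R * (D j * expR (- j%:R)) =
      D j * (expR 1 / 2 * N%:R * expR (- j%:R)) :> R by ring.
  move/le_trans; apply; rewrite le_eqVlt; apply/orP; left; apply/eqP; ring.
rewrite big_split/= -!mulr_sumr.
have -> : \sum_(j < J) D j = J%:R ^+ n.
  rewrite -(big_mkord xpredT D) telescope_sumr//.
  by rewrite expr0n gtn_eqF// subr0.
have cE : 0 <= expR 1 ^+ 2 * n.+2`!%:R / 2 * N%:R :> R.
  by rewrite mulr_ge0// mulr_ge0// mulr_ge0// sqr_ge0.
have := ler_wpM2l cE (sum_inv_sqr_le J).
have JJ : J%:R ^+ n <= 2 ^+ n * lam ^+ n.
  by rewrite -exprMn lerXn2r ?nnegrE// mulr_ge0// (le_trans _ lam1).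
have := ler_wpM2l age0 JJ.
have P0 : 0 <= 2 ^+ n * N%:R :> R by rewrite mulr_ge0// exprn_ge0.
have P1 : 0 <= expR 1 ^+ 2 * n.+2`!%:R * (a * lam ^+ n).
  by rewrite mulr_ge0 ?mulr_ge0 ?sqr_ge0// exprn_ge0// (le_trans _ lam1).
have P2 : 0 <= a * (2 ^+ n * lam ^+ n).
  by rewrite mulr_ge0 ?mulr_ge0 ?exprn_ge0// (le_trans _ lam1).
rewrite /c; move: P0 P1 P2.
move: (expR 1 ^+ 2 * _) (2 ^+ n) (lam ^+ n) (N%:R) (J%:R ^+ n) (\sum_(_ < _) _).
move=> e2 tn ln M Jn S; lra.
Qed.

Section Product.
Variables (n : nat) (y : 'I_n.+1 -> 'I_N -> R) (K : R) (a : 'I_n.+1 -> R).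
Hypotheses (n0 : (0 < n)%N) (y0 : forall k i, 0 <= y k i) (K0 : 0 < K)
  (a0 : forall k, 1 <= 4 * a k).
Hypothesis yI : forall k (I : {set 'I_N}), (0 < #|I|)%N ->
  \sum_(i in I) y k i <= K * (a k + mlog N #|I|).

Local Notation lam := (1 + ln N%:R : R).

Lemma card_neq (k : 'I_n.+1) : #|[pred k' | k' != k]| = n.
Proof.
by have := cardC1 k; rewrite card_ord.
Qed.

(** Where all factors are moderate the largest of them controls the product; where one
    of them is large the other factors are bounded by their maxima. *)
Lemma prod_le_large_moderate i :
  \prod_k y k i <=
  \sum_(k | 4 * K * lam < y k i) y k i * \prod_(k' | k' != k) (K * (a k' + lam)) +
  \sum_(k | y k i <= 4 * K * lam) y k i ^+ n.+1.
Proof.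
have A0 k : 0 <= \prod_(k' | k' != k) (K * (a k' + lam)).
  apply: prodr_ge0 => k' _; exact: le_trans (y0 k' i) (entry_le (yI k') i).
have s1 : 0 <= \sum_(k | 4 * K * lam < y k i)
    y k i * \prod_(k' | k' != k) (K * (a k' + lam)).
  by apply: sumr_ge0 => k _; rewrite mulr_ge0.
have s2 : 0 <= \sum_(k | y k i <= 4 * K * lam) y k i ^+ n.+1.
  by apply: sumr_ge0 => k _; rewrite exprn_ge0.
have [/existsP[k large]|/existsPn moderate] :=
    boolP [exists k, 4 * K * lam < y k i].
  rewrite ler_wpDr// (bigD1 k)//= [leRHS](bigD1 k)//= ler_wpDr//.
    by apply: sumr_ge0 => k' _; rewrite mulr_ge0.
  rewrite ler_wpM2l//; apply: ler_prod => k' _.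
  by rewrite y0 entry_le//; exact: yI.
pose k := [arg max_(k > ord0) y k i]%O.
have ymax k' : y k' i <= y k i.
  by rewrite /k; case: arg_maxP => // j _; exact.
rewrite ler_wpDl// [leRHS](bigD1 k)/=; last by rewrite leNgt moderate.
rewrite ler_wpDr ?sumr_ge0//; first by move=> k' _; rewrite exprn_ge0.
rewrite -[X in _ ^+ X](card_ord n.+1) -prodr_const.
by apply: ler_prod => k' _; rewrite y0 ymax.
Qed.

Lemma sum_prod_le :
  \sum_i \prod_k y k i <= (10 + moderate_const n * n.+1%:R) * K ^+ n.+1 *
    (N%:R + \sum_k a k * \prod_(k' | k' != k) (a k' + lam)).
Proof.
have age0 k : 0 <= a k by move: (a0 k); lra.
have lam0 : 0 <= lam by exact: le_trans lam_ge1.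
have mc0 : 0 <= moderate_const n.
  by rewrite mulr_ge0 ?exprn_ge0// addr_ge0 ?exprn_ge0// mulr_ge0// sqr_ge0.
pose Q k := \prod_(k' | k' != k) (a k' + lam).
have Q0 k : 0 <= Q k by apply: prodr_ge0 => k' _; rewrite addr_ge0.
have lamQ k : lam ^+ n <= Q k.
  rewrite -(card_neq k) -prodr_const; apply: ler_prod => k' _.
  by rewrite lam0 lerDr age0.
have KQ k : \prod_(k' | k' != k) (K * (a k' + lam)) = K ^+ n * Q k.
  by rewrite big_split/= prodr_const card_neq.
apply: le_trans (ler_sum _ (fun i _ => prod_le_large_moderate i)) _.
rewrite big_split/=.
under eq_bigr do rewrite big_mkcond.
rewrite exchange_big/=.
under [X in _ + X]eq_bigr do rewrite big_mkcond.
rewrite [X in _ + X]exchange_big/=.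
have large k : \sum_i (if 4 * K * lam < y k i then
    y k i * \prod_(k' | k' != k) (K * (a k' + lam)) else 0) <=
    10 * K ^+ n.+1 * (a k * Q k).
  rewrite -big_mkcond -mulr_suml KQ.
  have KQ0 : 0 <= K ^+ n * Q k by rewrite mulr_ge0// exprn_ge0// ltW.
  have := ler_wpM2r KQ0 (large_entries_sum_le K0 (a0 k) (yI k)).
  move/le_trans; apply; rewrite le_eqVlt; apply/orP; left; apply/eqP.
  by rewrite exprS; ring.
have moderate k : \sum_i (if y k i <= 4 * K * lam then y k i ^+ n.+1 else 0) <=
    moderate_const n * K ^+ n.+1 * (N%:R + a k * Q k).
  rewrite -big_mkcond.
  apply: le_trans (moderate_entries_pow_le n0 (y0 k) K0 (a0 k) (yI k)) _.
  rewrite ler_wpM2l ?mulr_ge0 ?exprn_ge0 ?(ltW K0)//.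
  by rewrite lerD2l ler_wpM2l.
apply: le_trans (lerD (ler_sum _ (fun k _ => large k))
                      (ler_sum _ (fun k _ => moderate k))) _.
rewrite -!mulr_sumr big_split/= sumr_const card_ord -[N%:R *+ _]mulr_natl.
rewrite -/(Q _); set S := \sum_k a k * Q k.
have S0 : 0 <= S by apply: sumr_ge0 => k _; rewrite mulr_ge0.
have Kn : 0 <= K ^+ n.+1 by rewrite exprn_ge0// ltW.
have -> : 10 * K ^+ n.+1 * S + moderate_const n * K ^+ n.+1 * (n.+1%:R * N%:R + S) =
  K ^+ n.+1 * (10 * S + moderate_const n * (n.+1%:R * N%:R + S)) by ring.
have -> : (10 + moderate_const n * n.+1%:R) * K ^+ n.+1 * (N%:R + S) =
  K ^+ n.+1 * ((10 + moderate_const n * n.+1%:R) * (N%:R + S)) by ring.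
rewrite ler_wpM2l//.
have n1 : 1 <= n.+1%:R :> R by rewrite ler1n.
have mS : moderate_const n * S <= moderate_const n * n.+1%:R * S.
  by rewrite ler_wpM2r// ler_peMr.
have NN : 0 <= N%:R :> R by [].
lra.
Qed.

End Product.

End Deterministic.

(** * Assembling the bound *)

Section Degenerate.
Context (dW d : measure_display) (W : measurableType dW) (T : measurableType d)
        (R : realType).
Variables (P : probability W R) (mu : probability T R) (N : nat)
          (X : 'I_N -> {RV P >-> T}).
Hypothesis iidX : iid_with_law mu X.

(** A function of norm zero admits every [c > 0], so the tails hold with [c] as small as
    desired at each level. *)
Lemma zero_diam_vanish (F : set (T -> R)) (q u : R) : (0 < N)%N -> 0 <= q ->
  F !=set0 -> (forall f, F f -> measurable_fun setT f) ->
  separable_class X F -> psi2_diam mu F = 0%E ->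
  exists B : set W, [/\ measurable B, (P B <= (expR (- q - u ^+ 2))%:E)%E &
    forall w, ~ B w -> forall f i, F f -> f (X i w) = 0].
Proof.
move=> N0 q0 [a Fa] mF [S [cS SF] sepS] FD.
have [g [ga gS]] := card_le_enum a cS.
have Fg n : F (g n) by case: (ga n) => [->//|/SF].
pose Z s := 2 * mlog N 1 + (8 + q) * ((2 ^ s)%:R + mlog N 1 + u ^+ 2).
have Z0 s : 0 < Z s.
  have L1 : 1 <= mlog N 1 :> R by exact: mlog_ge1.
  have L0 : 0 < mlog N 1 :> R by exact: lt_le_trans L1.
  have : 0 <= (8 + q) * ((2 ^ s)%:R + mlog N 1 + u ^+ 2).
    by rewrite mulr_ge0 ?addr_ge0 ?sqr_ge0 ?(ltW L0).
  by rewrite /Z; move: L0; lra.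
pose c s : R := Num.sqrt (s.+1%:R^-1 / Z s).
have c0 s : 0 < c s by rewrite sqrtr_gt0 divr_gt0// invr_gt0.
have hc s j : subgauss mu (g j) (c s).
  apply: psi2_norm_lt; first exact: mF.
  by apply: le_lt_trans (psi2_diam_ub mu (Fg j)) _; rewrite FD lte_fin.
have Mle s : (s.+1 <= 2 ^ (5 * 2 ^ s))%N.
  apply: (leq_trans (ltn_expl s (ltnSn 1))).
  by rewrite leq_exp2l// (leq_trans (ltnW (ltn_expl s (ltnSn 1))))// leq_pmull.
have [B [mB PB HB]] := uniform_subset_bound (h := fun s j => g j)
  (c := fun s j => c s) iidX u N0 q0 Mle (fun s j => mF _ (Fg j)) hc.
case: sepS => V [mV PV0 HV].
exists (B `|` V); split.
- exact: measurableU.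
- by apply: le_trans (measureU2 P mB mV) _; rewrite [X in (_ + X)%E]PV0 adde0.
move=> w /not_orP[Bw Vw] f i Ff.
have {HV}sepw := contrapT (fun h => Vw (HV w h)).
have g_0 j : g j (X i w) = 0.
  apply/eqP; rewrite -sqrf_eq0; apply/negPn/negP => gj.
  have gj0 : 0 < g j (X i w) ^+ 2 by rewrite lt0r gj sqr_ge0.
  pose s := maxn j (Num.truncn (g j (X i w) ^+ 2)^-1).
  have := HB w Bw s j [set i]%SET; rewrite cards1 big_set1 ltnS leq_maxl.
  move=> /(_ isT isT); rewrite sqr_sqrtr; last by rewrite divr_ge0 ?invr_ge0// ltW.
  rewrite -/(Z s) divfK ?gt_eqF// leNgt => /negP; apply.
  rewrite -[ltRHS]invrK ltf_pV2 ?posrE ?invr_gt0//.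
  apply: lt_le_trans (truncnS_gt _) _.
  by rewrite ler_nat ltnS leq_maxr.
apply/eqP; rewrite -normr_eq0 eq_le normr_ge0 andbT.
apply/ler_addgt0Pr => e e0; rewrite add0r.
have [_ /gS[j _ <-] /(_ i)] := sepw f Ff e e0.
by rewrite g_0 sub0r normrN => /ltW.
Qed.

End Degenerate.

Lemma sum_sqr_le (R : realDomainType) (I : finType) (x : I -> R) :
  (forall i, 0 <= x i) -> \sum_i x i ^+ 2 <= (\sum_i x i) ^+ 2.
Proof.
move=> x0; rewrite [leRHS]expr2 mulr_suml; apply: ler_sum => i _.
rewrite expr2 ler_wpM2l// (bigD1 i)//= lerDl.
exact: sumr_ge0.
Qed.

Section Constants.
Context (R : realType).

(** As [g >= 1 / 2] and [u >= u0], both [g] and [u] are at most a constant times [u g];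
    this is where the dependence on [u0] enters. *)
Lemma rate_le (n N : nat) (g : 'I_n.+1 -> R) (u0 u : R) : (0 < N)%N ->
  0 < u0 -> u0 <= u -> (forall k, 1 <= 2 * g k) ->
  N%:R + \sum_k ((g k + 1) ^+ 2 + u ^+ 2) *
    \prod_(k' | k' != k) ((g k' + 1) ^+ 2 + u ^+ 2 + (1 + ln N%:R)) <=
  (1 + (9 / u0 ^+ 2 + 4) * 13 ^+ n) * (Num.sqrt N%:R + u * \sum_k (g k *
    \prod_(k' | k' != k) (g k' + Num.sqrt (ln N%:R) + u))) ^+ 2.
Proof.
move=> N0 u00 u0u g1; set l := Num.sqrt (ln _).
have u_gt0 : 0 < u by exact: lt_le_trans u0u.
have l0 : 0 <= l by exact: sqrtr_ge0.
have lK : l ^+ 2 = ln N%:R by rewrite sqr_sqrtr// ln_ge0// ler1n.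
have g0 k : 0 <= g k by move: (g1 k); lra.
pose Q k := \prod_(k' | k' != k) (g k' + l + u).
have Q0 k : 0 <= Q k by apply: prodr_ge0 => k' _; rewrite !addr_ge0// ltW.
pose c3 : R := (9 / u0 ^+ 2 + 4) * 13 ^+ n.
have c30 : 0 <= c3.
  by rewrite mulr_ge0 ?exprn_ge0// addr_ge0// divr_ge0// exprn_ge0// ltW.
have prod_le k : \prod_(k' | k' != k) ((g k' + 1) ^+ 2 + u ^+ 2 + (1 + ln N%:R)) <=
    13 ^+ n * Q k ^+ 2.
  have -> : 13 ^+ n = \prod_(k' | k' != k) 13 :> R by rewrite prodr_const card_neq.
  rewrite -prodrXl -big_split/=.
  apply: ler_prod => k' _; apply/andP; split.
    by rewrite !addr_ge0 ?sqr_ge0// -lK sqr_ge0.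
  rewrite -lK; have := g1 k'; have := g0 k'; move: (g k') l0 (ltW u_gt0).
  by clear; move=> x l0 u0 x0 x1; rewrite !expr2; nra.
have fac_le k : (g k + 1) ^+ 2 + u ^+ 2 <= (9 / u0 ^+ 2 + 4) * (u * g k) ^+ 2.
  have uu0 : 1 <= u ^+ 2 / u0 ^+ 2.
    by rewrite ler_pdivlMr ?exprn_gt0// mul1r lerXn2r// nnegrE ltW.
  have gg : (g k + 1) ^+ 2 <= 9 * g k ^+ 2.
    by have := g1 k; have := g0 k; rewrite !expr2; nra.
  have -> : (9 / u0 ^+ 2 + 4) * (u * g k) ^+ 2 =
      9 * g k ^+ 2 * (u ^+ 2 / u0 ^+ 2) + (2 * g k) ^+ 2 * u ^+ 2.
    by field; rewrite gt_eqF.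
  apply: lerD; first by apply: le_trans gg _; rewrite ler_peMr// mulr_ge0 ?sqr_ge0.
  by rewrite ler_peMl ?sqr_ge0// exprn_ege1.
have N00 : 0 <= N%:R :> R by [].
pose T := \sum_k (g k * Q k); rewrite -/T.
apply: (@le_trans _ _ (N%:R + c3 * \sum_k (u * (g k * Q k)) ^+ 2)).
  rewrite lerD2l mulr_sumr; apply: ler_sum => k _.
  have -> : c3 * (u * (g k * Q k)) ^+ 2 =
      ((9 / u0 ^+ 2 + 4) * (u * g k) ^+ 2) * (13 ^+ n * Q k ^+ 2).
    by rewrite /c3; field; rewrite gt_eqF.
  apply: ler_pM => //; first by rewrite addr_ge0 ?sqr_ge0.
  by apply: prodr_ge0 => k' _; rewrite !addr_ge0 ?sqr_ge0// -lK sqr_ge0.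
have := sum_sqr_le (x := fun k => u * (g k * Q k)).
rewrite -mulr_sumr -/c3 => /(_ (fun k => mulr_ge0 (ltW u_gt0) (mulr_ge0 (g0 k) (Q0 k)))).
rewrite -/T; set S := \sum_k _ ^+ 2 => ST.
have T0 : 0 <= u * T by rewrite mulr_ge0 ?(ltW u_gt0)//; apply: sumr_ge0 => k _; exact: mulr_ge0 (g0 k) (Q0 k).
have sN : Num.sqrt N%:R ^+ 2 = N%:R :> R by rewrite sqr_sqrtr.
have s0 : 0 <= Num.sqrt N%:R :> R by exact: sqrtr_ge0.
apply: (@le_trans _ _ ((1 + c3) * (N%:R + (u * T) ^+ 2))).
  have c3S := ler_wpM2l c30 ST; have c3N := mulr_ge0 c30 N00.
  have := sqr_ge0 (u * T); lra.
rewrite ler_wpM2l ?addr_ge0// -{1}sN sqrrD addrAC lerDl.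
by rewrite mulrn_wge0// mulr_ge0.
Qed.

End Constants.

Section ExtendedValues.
Context (R : realType) (n : nat) (s l u c : R) (D G : 'I_n.+1 -> \bar R).
Hypotheses (s0 : 0 < s) (l0 : 0 <= l) (u0 : 0 < u) (c0 : 0 < c).
Hypotheses (D0 : forall k, (0 < D k)%E) (G0 : forall k, (0 <= G k)%E).

Lemma prode_gt0 (I : finType) (Q : pred I) (x : I -> \bar R) :
  (forall i, 0 < x i)%E -> (0 < \prod_(i | Q i) x i)%E.
Proof. by move=> x0; elim/big_ind: _ => //; exact: mule_gt0. Qed.

Let ratio_ge0 k : (0 <= G k / D k)%E.
Proof. by rewrite mule_ge0// inve_ge0 ltW. Qed.

Let factor_gt0 k : (0 < G k / D k + l%:E + u%:E)%E.
Proof.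
apply: (@lt_le_trans _ _ u%:E); first by rewrite lte_fin.
by rewrite leeDr// adde_ge0// lee_fin.
Qed.

Lemma bound_pinfty : (exists k, D k = +oo%E \/ G k = +oo%E) ->
  (c%:E * ((\prod_k D k) * (s%:E + u%:E * \sum_k (G k / D k *
     \prod_(k' | k' != k) (G k' / D k' + l%:E + u%:E)))) = +oo)%E.
Proof.
have term_ge0 k : (0 <= G k / D k *
    \prod_(k' | k' != k) (G k' / D k' + l%:E + u%:E))%E.
  by rewrite mule_ge0//; apply: prode_ge0 => k' _; exact: ltW.
have DD : (0 < \prod_k D k)%E by exact: prode_gt0.
move=> oo; have [[k Dk]|Dfin] := pselect (exists k, D k = +oo%E).
  rewrite (bigD1 k)//= Dk gt0_mulye ?prode_gt0// gt0_mulye.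
    by rewrite gt0_muley ?lte_fin.
  rewrite (lt_le_trans (_ : 0 < s%:E)%E) ?lte_fin// leeDl//.
  by apply: mule_ge0; [rewrite lee_fin ltW|apply: sume_ge0].
have [k Gk] : exists k, G k = +oo%E.
  by case: oo => k [Dk|Gk]; [case: Dfin; exists k|exists k].
have Dk : D k != +oo%E by apply/eqP => Dk; apply: Dfin; exists k.
have rk : (0 < (D k)^-1)%E by rewrite inve_gt0 ?(gt_eqF (D0 k)).
rewrite [X in (u%:E * X)%E](bigD1 k)//= Gk gt0_mulye// gt0_mulye ?prode_gt0//.
rewrite addye; last first.
  by rewrite gt_eqF// (lt_le_trans ltNy0)//; apply: sume_ge0.
by rewrite gt0_muley ?lte_fin// addey// gt0_muley// gt0_muley ?lte_fin.
Qed.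

End ExtendedValues.

(* The constant depends on p and on a lower bound u0 for u only; with u0 = 1 it
   depends on p only.  The range 0 < u < u0 cannot share the same constant. *)
Theorem theorem4p5 (R : realType) (p : nat) (u0 : R) :
  (2 <= p)%N -> 0 < u0 ->
  exists2 c : R, 0 < c &
  forall (N : nat)
         (dW : measure_display) (W : measurableType dW) (P : probability W R)
         (d : 'I_p -> measure_display)
         (Omega : forall k : 'I_p, measurableType (d k))
         (mu : forall k : 'I_p, probability (Omega k) R)
         (X : forall k : 'I_p, 'I_N -> {RV P >-> Omega k})
         (F : forall k : 'I_p, set (Omega k -> R)),
    (0 < N)%N ->
    (forall k, iid_with_law (mu k) (X k)) ->
    (forall k f, F k f -> measurable_fun setT f) ->
    (forall k, separable_class (X k) (F k)) ->
    (forall k, F k 0 \/ (forall f, F k f -> F k (- f))) ->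
    forall u : R, u0 <= u ->
    with_probability_at_least P (1 - expR (- u ^+ 2))
      [set w | (ereal_sup
         [set (Num.sqrt (\sum_(i < N) \prod_(k < p) (f k (X k i w)) ^+ 2))%:E
            | f in [set f : forall k : 'I_p, Omega k -> R
                      | forall k, F k (f k)]]
       <= c%:E *
          ((\prod_(k < p) psi2_diam (mu k) (F k)) *
           ((Num.sqrt N%:R)%:E +
            u%:E * \sum_(k < p) (gamma_bar (mu k) (F k) *
              \prod_(k' < p | k' != k)
                (gamma_bar (mu k') (F k') +
                 (Num.sqrt (ln N%:R))%:E + u%:E)))))%E].
Proof.
case: p => [//|n]; rewrite ltnS => n0 u00.
(* With [q = p] the union over the [p] classes costs [p * exp (- p) <= 1]. *)
pose q : R := n.+1%:R.
have q0 : 0 <= q by [].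
pose K : R := 200 * (18 + 2 * q).
have K0 : 0 < K by rewrite mulr_gt0// ltr_wpDr// mulr_ge0.
pose C1 : R := (10 + moderate_const R n * n.+1%:R) * K ^+ n.+1.
have mc0 : 0 <= moderate_const R n.
  by rewrite mulr_ge0 ?exprn_ge0// addr_ge0 ?exprn_ge0// mulr_ge0// sqr_ge0.
have C10 : 0 < C1 by rewrite mulr_gt0 ?exprn_gt0// ltr_wpDr// mulr_ge0.
pose C3 : R := 1 + (9 / u0 ^+ 2 + 4) * 13 ^+ n.
have C30 : 0 < C3.
  rewrite ltr_wpDr// mulr_ge0 ?exprn_ge0// addr_ge0// divr_ge0 ?exprn_ge0//.
  exact: ltW.
have c0 : 0 < Num.sqrt (C1 * C3) by rewrite sqrtr_gt0 mulr_gt0.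
exists (Num.sqrt (C1 * C3)) => // N dW W P d Omega mu X F N0 iidX mF sepF F0N u u0u.
set E := [set w | _].
have u_gt0 : 0 < u by exact: lt_le_trans u0u.
have sure : (forall w, E w) -> with_probability_at_least P (1 - expR (- u ^+ 2)) E.
  move=> Ew; exists setT; split=> //.
  by rewrite probability_setT lee_fin gerBl expR_ge0.
have [ne|/existsNP[k Fk]] := pselect (forall k, F k !=set0); last first.
  apply: sure => w; apply: ge_ereal_sup => _ [f Ff <-].
  by case: Fk; exists (f k); exact: Ff.
have reduce (B : 'I_n.+1 -> set W) : (forall k, measurable (B k)) ->
    (forall k, (P (B k) <= (expR (- q - u ^+ 2))%:E)%E) ->
    (forall w, (forall k, ~ B k w) -> E w) ->
    with_probability_at_least P (1 - expR (- u ^+ 2)) E.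
  move=> mB PB BE; pose B' j := B (inord j).
  pose U := \big[setU/set0]_(j < n.+1) B' j.
  have mU : measurable U by apply: bigsetU_measurable => j _; exact: mB.
  exists (~` U); split; first exact: measurableC.
    move=> w Uw; apply: BE => k Bk; apply: Uw.
    rewrite /U -bigcup_mkord; exists (val k); first exact: (ltn_ord k).
    by rewrite /B' inord_val.
  rewrite probability_setC// EFinB leeB//.
  apply: le_trans (measure_bigsetU_le (fun j _ => mB (inord j))
    (fun j _ => PB (inord j))) _.
  rewrite lee_fin expRD mulrA ler_piMl ?expR_ge0// expRN ler_pdivrMr ?expR_gt0//.
  by rewrite mul1r (le_trans _ (expR_ge1Dx q))// lerDr.
have diam_ge0 k : (0 <= psi2_diam (mu k) (F k))%E.
  have [f Ff] := ne k; apply: le_trans (psi2_diam_ub (mu k) Ff).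
  exact: psi2_norm_ge0.
have [[k0 Dk0]|Dn0] := pselect (exists k, psi2_diam (mu k) (F k) = 0%E).
  have [B [mB PB HB]] := zero_diam_vanish (iidX k0) u N0 q0 (ne k0) (mF k0)
    (sepF k0) Dk0.
  apply: (reduce (fun=> B)) => // w Bw; apply: ge_ereal_sup => _ [f Ff <-].
  have -> : \sum_(i < N) \prod_(k < n.+1) f k (X k i w) ^+ 2 = 0.
    by apply: big1 => i _; rewrite (bigD1 k0)//= (HB w (Bw k0))// expr0n mul0r.
  by rewrite sqrtr0 [X in (_ * (X * _))%E](bigD1 k0)//= Dk0 !mul0e mule0.
have D0 k : (0 < psi2_diam (mu k) (F k))%E.
  by rewrite lt0e diam_ge0 andbT; apply/eqP => Dk; apply: Dn0; exists k.
have diam_gamma k := psi2_diam_le_gamma (mu k) (mF k) (F0N k).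
have G0 k : (0 <= gamma_psi2 (mu k) (F k))%E.
  have := le_trans (diam_ge0 k) (diam_gamma k).
  by rewrite pmule_rge0.
have sN0 : 0 < Num.sqrt N%:R :> R by rewrite sqrtr_gt0 ltr0n.
have l0 : 0 <= Num.sqrt (ln N%:R) :> R by exact: sqrtr_ge0.
have [inf|fin] := pselect (exists k, psi2_diam (mu k) (F k) = +oo%E \/
    gamma_psi2 (mu k) (F k) = +oo%E).
  apply: sure => w; apply: ge_ereal_sup => _ [f Ff <-].
  by rewrite (bound_pinfty sN0 l0 u_gt0 c0 D0 G0 inf) leey.
pose D k := fine (psi2_diam (mu k) (F k)).
pose G k := fine (gamma_psi2 (mu k) (F k)).
have DE k : psi2_diam (mu k) (F k) = (D k)%:E.
  rewrite fineK// ge0_fin_numE// ltey; apply/eqP => h.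
  by apply: fin; exists k; left.
have GE k : gamma_psi2 (mu k) (F k) = (G k)%:E.
  rewrite fineK// ge0_fin_numE// ltey; apply/eqP => h.
  by apply: fin; exists k; right.
have Dr0 k : 0 < D k by rewrite -lte_fin -DE.
have Gr0 k : 0 <= G k by rewrite -lee_fin -GE.
have [B BP] := choice (fun k => class_subset_bound (iidX k) u N0 q0 (Dr0 k) (Gr0 k)
  (ne k) (mF k) (sepF k) (DE k) (GE k)).
apply: (reduce B) => [k|k|w Bw]; [by case: (BP k)|by case: (BP k)|].
apply: ge_ereal_sup => _ [f Ff <-].
pose g k := G k / D k.
have gE k : gamma_bar (mu k) (F k) = (g k)%:E.
  by rewrite /gamma_bar DE GE inver gt_eqF.
pose T := \sum_k (g k * \prod_(k' | k' != k) (g k' + Num.sqrt (ln N%:R) + u)).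
set rhs := (X in (_ <= X)%E).
have -> : rhs = (Num.sqrt (C1 * C3) * ((\prod_k D k) * (Num.sqrt N%:R + u * T)))%:E.
  rewrite /rhs !EFinM EFinD EFinM -prodEFin -sumEFin.
  congr (_ * (_ * (_ + _ * _)))%E; first by apply: eq_bigr => k _.
  apply: eq_bigr => k _; rewrite gE (EFinM (g k)) -prodEFin; congr (_ * _)%E.
  by apply: eq_bigr => k' _; rewrite gE !EFinD.
rewrite lee_fin.
(* Dividing by the diameters gives the subset bounds with parameter [a k]. *)
pose y k i := f k (X k i w) ^+ 2 / D k ^+ 2.
have y0 k i : 0 <= y k i by rewrite divr_ge0 ?sqr_ge0.
pose a k := (g k + 1) ^+ 2 + u ^+ 2.
have g1 k : 1 <= 2 * g k.
  rewrite /g mulrA ler_pdivlMr// mul1r.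
  have := diam_gamma k.
  by rewrite DE GE -EFinM lee_fin.
have a1 k : 1 <= 4 * a k.
  rewrite /a; have := sqr_ge0 u; have := g1 k; rewrite !expr2; nra.
have yI k (I : {set 'I_N}) : (0 < #|I|)%N ->
    \sum_(i in I) y k i <= K * (a k + mlog N #|I|).
  move=> I0; have [_ _ BI] := BP k.
  rewrite -mulr_suml ler_pdivrMr ?exprn_gt0//.
  apply: le_trans (BI w (Bw k) (f k) I (Ff k) I0) _.
  rewrite le_eqVlt; apply/orP; left; apply/eqP.
  by rewrite /K /a /g; field; rewrite gt_eqF.
have prodE : \sum_(i < N) \prod_(k < n.+1) f k (X k i w) ^+ 2 =
    (\prod_k D k) ^+ 2 * \sum_i \prod_k y k i.
  rewrite mulr_sumr; apply: eq_bigr => i _.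
  rewrite -prodrXl -big_split/=; apply: eq_bigr => k _.
  by rewrite mulrC divfK// sqrf_eq0 gt_eqF.
have T0 : 0 <= T.
  have g0 k : 0 <= g k by rewrite divr_ge0 ?(ltW (Dr0 k)).
  apply: sumr_ge0 => k _; rewrite mulr_ge0//; apply: prodr_ge0 => k' _.
  by rewrite !addr_ge0 ?(ltW u_gt0).
have PD0 : 0 <= \prod_k D k by apply: prodr_ge0 => k _; exact: ltW.
have B0 : 0 <= Num.sqrt N%:R + u * T by rewrite addr_ge0 ?(ltW sN0)// mulr_ge0 ?(ltW u_gt0).
rewrite -[leRHS]ger0_norm; last by rewrite !mulr_ge0 ?(ltW c0).
rewrite -sqrtr_sqr ler_wsqrtr// prodE exprMn sqr_sqrtr; last first.
  by rewrite mulr_ge0 ?(ltW C10) ?(ltW C30).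
rewrite exprMn [leRHS]mulrCA ler_wpM2l ?sqr_ge0//.
apply: le_trans (sum_prod_le N0 n0 y0 K0 a1 yI) _.
rewrite -/C1 -[leRHS]mulrA ler_pM2l//.
exact: rate_le.
Qed.
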